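(* Let $d\ge1$, $L>0$, and let $c_0>0$ be a constant. For integers $M\ge2$, $n\ge1$ with $M\le c_0n$, $\psi_n(M)=LM/n$ is the optimal rate of convex aggregation over $\mathcal{P}_0$ (that is, the optimal rate of aggregation for $H=\Lambda^M$ over $\mathcal{P}_0$), and the convex aggregate $\tilde p_n^{\mathbf C}$ with $H=\Lambda^M$ is a rate optimal aggregate for $\Lambda^M$ over $\mathcal{P}_0$. Explicitly, there are constants $C<\infty$ and $c>0$ independent of $M$ and $n$ such that for every $M\ge2$: (i) for any functions $p_1,\dots,p_M\in L_2(\mathbb{R}^d)$ and any $n\ge1$ with $M\le c_0n$, $$\sup_{p\in\mathcal{P}_0}\Big[R_n(\tilde p_n^{\mathbf C},p)-\inf_{\lambda\in\Lambda^M}\|\mathsf{p}_\lambda-p\|^2\Big]\le C\,\frac{LM}{n};$$ (ii) there exist functions $p_1,\dots,p_M\in L_2(\mathbb{R}^d)$ such that for any $n\ge1$ with $M\le c_0n$ and all estimators $T_n$ of $p$ based on $X_1,\dots,X_n$, $$\sup_{p\in\mathcal{P}_0}\Big[R_n(T_n,p)-\inf_{\lambda\in\Lambda^M}\|\mathsf{p}_\lambda-p\|^2\Big]\ge c\,\frac{LM}{n}.$$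
   Context: $X_1,\dots,X_n$ are i.i.d. random vectors in $\mathbb{R}^d$ with density $p$. $\|\cdot\|$ is the $L_2(\mathbb{R}^d)$ norm and $\|\cdot\|_\infty$ the $L_\infty(\mathbb{R}^d)$ norm. $\mathcal{P}_0$ is the class of all probability densities $p$ on $\mathbb{R}^d$ with $\|p\|_\infty\le L$. $\Lambda^M=\{\lambda\in\mathbb{R}^M:\lambda_j\ge0,\ \sum_{j=1}^M\lambda_j\le1\}$. For $\lambda\in\mathbb{R}^M$, $\mathsf{p}_\lambda=\sum_{j=1}^M\lambda_jp_j$. For an estimator $T_n$, $R_n(T_n,p)=E_p^n\|T_n-p\|^2$, where $E_p^n$ is the expectation under density $p$. Convex aggregate (with $H=\Lambda^M$): $\tilde p_n^{\mathbf C}=\mathsf{p}_{\hat\lambda^{\mathbf C}}$ with $\hat\lambda^{\mathbf C}\in\operatorname{argmin}_{\lambda\in\Lambda^M}\{\|\mathsf{p}_\lambda\|^2-\frac2n\sum_{i=1}^n\mathsf{p}_\lambda(X_i)\}$. Definition (optimal rate of aggregation): for a class $\mathcal{P}$ of densities and $H\subseteq\mathbb{R}^M$, positive numbers $\psi_n(M)$ are called an optimal rate of aggregation for $H$ over $\mathcal{P}$ if (a) for any $p_1,\dots,p_M\in L_2(\mathbb{R}^d)$ there is an estimator $\tilde p_n$ with $\sup_{p\in\mathcal{P}}[R_n(\tilde p_n,p)-\inf_{\lambda\in H}\|\mathsf{p}_\lambda-p\|^2]\le C\psi_n(M)$ for any integer $n\ge1$, with $C<\infty$ independent of $M,n$;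 and (b) there exist $p_1,\dots,p_M\in L_2(\mathbb{R}^d)$ such that for all estimators $T_n$, $\sup_{p\in\mathcal{P}}[R_n(T_n,p)-\inf_{\lambda\in H}\|\mathsf{p}_\lambda-p\|^2]\ge c\psi_n(M)$ for any integer $n\ge1$, with $c>0$ independent of $M,n$. When (b) holds, an aggregate satisfying (a) is called rate optimal for $H$ over $\mathcal{P}$. Here the definition is applied with $n$ restricted to $M\le c_0n$. *)

(* Defs.v *)
From HB Require Import structures.
From mathcomp Require Import all_boot all_order all_algebra.
From mathcomp Require Import all_classical all_reals all_analysis.

Set Implicit Arguments.
Unset Strict Implicit.
Unset Printing Implicit Defensive.

Import Order.TTheory GRing.Theory Num.Theory.
Import numFieldNormedType.Exports.

Local Open Scope classical_set_scope.
Local Open Scope ring_scope.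

(** Tensor powers of a sigma-finite measure, on n.-tuple T equipped with the
    library's product sigma-algebra. *)

Section cons_measure.
Context (dT : measure_display) (T : measurableType dT) (R : realType).
Context (n : nat).
Variables (mu : {sigma_finite_measure set T -> \bar R}).
Variables (nu : {sigma_finite_measure set (n.-tuple T) -> \bar R}).

Definition tuple_cons (z : T * n.-tuple T) : n.+1.-tuple T :=
  [the n.+1.-tuple T of z.1 :: z.2].

Lemma measurable_tuple_cons : measurable_fun setT tuple_cons.
Proof. exact: measurable_cons. Qed.

Definition cons_measure : set (n.+1.-tuple T) -> \bar R :=
  pushforward (mu \x nu)%E tuple_cons.

Let cons_measure0 : cons_measure set0 = 0%E.
Proof. by rewrite /cons_measure /pushforward preimage_set0 measure0. Qed.

Let cons_measure_ge0 A : (0 <= cons_measure A)%E.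
Proof. by rewrite /cons_measure /pushforward. Qed.

Let cons_measure_sigma_additive : semi_sigma_additive cons_measure.
Proof.
move=> F mF tF mUF; rewrite /cons_measure /pushforward preimage_bigcup.
have mpre A : measurable A -> measurable (tuple_cons @^-1` A).
  by move=> mA; rewrite -[X in measurable X]setTI; exact: measurable_tuple_cons.
apply: measure_semi_sigma_additive.
- by move=> k; exact: mpre.
- apply/trivIsetP => /= i j _ _ ij; rewrite -preimage_setI.
  by move/trivIsetP : tF => /(_ _ _ _ _ ij) ->//; rewrite preimage_set0.
- by rewrite -preimage_bigcup; exact: mpre.
Qed.

HB.instance Definition _ := isMeasure.Build _ _ _ cons_measure
  cons_measure0 cons_measure_ge0 cons_measure_sigma_additive.

Let tuple_uncons (t : n.+1.-tuple T) : T * n.-tuple T :=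
  (thead t, [tuple of behead t] : n.-tuple T).

Let tuple_consK : cancel tuple_cons tuple_uncons.
Proof.
by case=> x t; rewrite /tuple_uncons /tuple_cons/= theadE; congr pair; apply/val_inj.
Qed.

Let measurable_tuple_uncons : measurable_fun setT tuple_uncons.
Proof.
apply/measurable_fun_pairP; split.
- exact: measurable_tnth.
- exact: measurable_behead.
Qed.

Let cons_measure_sigma_finite : sigma_finite setT cons_measure.
Proof.
have /sigma_finiteP[F [TF ndF Foo]] := sigma_finiteT mu.
have /sigma_finiteP[G [TG ndG Goo]] := sigma_finiteT nu.
exists (fun k => tuple_uncons @^-1` (F k `*` G k)).
  rewrite -preimage_bigcup; apply/esym/seteqP; split => // t _.
  have [i _ Fi] : (\bigcup_i F i) (thead t) by rewrite -TF.
  have [j _ Gj] : (\bigcup_i G i) (tuple_uncons t).2 by rewrite -TG.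
  exists (maxn i j) => //; split.
    by move: Fi; exact/subsetPset/ndF/leq_maxl.
  by move: Gj; exact/subsetPset/ndG/leq_maxr.
move=> k; have [mF Fk] := Foo k; have [mG Gk] := Goo k; split.
  rewrite -[X in measurable X]setTI.
  by apply: measurable_tuple_uncons => //; exact: measurableX.
rewrite /cons_measure /pushforward.
rewrite (_ : tuple_cons @^-1` _ = F k `*` G k).
  by rewrite product_measure1E// lte_mul_pinfty// ge0_fin_numE.
by rewrite -comp_preimage (_ : tuple_uncons \o _ = id)//; exact/funext.
Qed.

HB.instance Definition _ := Measure_isSigmaFinite.Build _ _ _ cons_measure
  cons_measure_sigma_finite.

End cons_measure.

Fixpoint tuple_measure (dT : measure_display) (T : measurableType dT)
    (R : realType) (mu : {sigma_finite_measure set T -> \bar R}) (n : nat) :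
    {sigma_finite_measure set (n.-tuple T) -> \bar R} :=
  match n with
  | 0 => \d_([tuple] : 0.-tuple T)
  | n'.+1 => cons_measure mu (tuple_measure mu n')
  end.

Lemma tuple_measure_box (dT : measure_display) (T : measurableType dT)
    (R : realType) (mu : {sigma_finite_measure set T -> \bar R}) (n : nat)
    (A : 'I_n -> set T) : (forall i, measurable (A i)) ->
  tuple_measure mu n [set t | forall i, A i (tnth t i)] =
  (\prod_(i < n) mu (A i))%E.
Proof.
elim: n A => [|n IHn] A mA /=.
  rewrite big_ord0 diracE mem_set//.
  by case.
rewrite /cons_measure /pushforward big_ord_recl -IHn//.
rewrite -product_measure1E//; last first.
  rewrite (_ : mkset _ =
      \bigcap_(i in [set: 'I_n]) (tnth (T:=T))^~ i @^-1` A (lift ord0 i)).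
    apply: fin_bigcap_measurable => // i _.
    by rewrite -[X in measurable X]setTI; exact: measurable_tnth.
  apply/seteqP; split => [t At i _|t At i]; first exact: At.
  exact: (At i Logic.I).
congr (_ _); apply/seteqP; split => -[x t] /=.
- move=> At; split; first exact: (At ord0).
  by move=> i; have := At (lift ord0 i); rewrite tnthS.
- by move=> [Ax At] i; have [j ->|->] := unliftP ord0 i; rewrite ?tnthS.
Qed.

(** Density estimation on R^d *)

(* [measurableTypeR R] is [R] with its Borel sigma-algebra, in the form on which
   [lebesgue_measure] is defined. *)
Notation Rd R d := (d.-tuple (measurableTypeR R)).

Definition leb (R : realType) (d : nat) :
    {sigma_finite_measure set (Rd R d) -> \bar R} :=
  tuple_measure (@lebesgue_measure R) d.

Section aggregation.
Context (R : realType) (d : nat).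
Local Open Scope ereal_scope.

Definition L2norm (f : Rd R d -> R) : \bar R := 'N[leb R d]_2%:E[EFin \o f].

Definition is_density (p : Rd R d -> R) : Prop :=
  [/\ measurable_fun setT p, (forall x, 0 <= p x)%R &
      \int[leb R d]_x (p x)%:E = 1].

Definition bounded_densities (L : R) : set (Rd R d -> R) :=
  [set p | is_density p /\ 'N[leb R d]_+oo[EFin \o p] <= L%:E].

(* Expectation of [f (X_1, ..., X_n)] for X_1, ..., X_n i.i.d. with density [p]:
   the sample has joint density [prod_i p (x_i)] on (R^d)^n. *)
Definition sample_expectation (n : nat) (p : Rd R d -> R)
    (f : n.-tuple (Rd R d) -> \bar R) : \bar R :=
  \int[tuple_measure (leb R d) n]_x ((\prod_(i < n) p (tnth x i))%:E * f x).

(* An estimator sends a sample to a function on R^d, jointly measurably. *)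
Definition is_estimator (n : nat) (T : n.-tuple (Rd R d) -> Rd R d -> R) :
    Prop :=
  measurable_fun setT (fun z : n.-tuple (Rd R d) * Rd R d => T z.1 z.2).

Definition risk (n : nat) (T : n.-tuple (Rd R d) -> Rd R d -> R)
    (p : Rd R d -> R) : \bar R :=
  sample_expectation p (fun x => L2norm (T x \- p)%R ^+ 2).

Definition mixture (M : nat) (ps : 'I_M -> Rd R d -> R) (lam : M.-tuple R) :
    Rd R d -> R :=
  fun x => (\sum_(j < M) tnth lam j * ps j x)%R.

(* The infimum is finite as soon as [p] and all the [ps j] are in L_2 and [H] is
   nonempty, so the subtraction below is then not of the form oo - oo. *)
Definition oracle_risk (M : nat) (H : set (M.-tuple R))
    (ps : 'I_M -> Rd R d -> R) (p : Rd R d -> R) : \bar R :=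
  ereal_inf [set L2norm (mixture ps lam \- p)%R ^+ 2 | lam in H].

Definition max_excess_risk (P : set (Rd R d -> R)) (M : nat)
    (H : set (M.-tuple R)) (ps : 'I_M -> Rd R d -> R)
    (n : nat) (T : n.-tuple (Rd R d) -> Rd R d -> R) : \bar R :=
  ereal_sup [set risk T p - oracle_risk H ps p | p in P].

Definition in_L2 (M : nat) (ps : 'I_M -> Rd R d -> R) : Prop :=
  forall j, ps j \in Lfun (leb R d) 2%:E.

(** Optimal rates of aggregation for [H M], where (M, n) ranges over the
    pairs allowed by [adm]. *)

Section rates.
Variables (adm : nat -> nat -> Prop) (H : forall M, set (M.-tuple R)).
Variables (P : set (Rd R d -> R)) (psi : nat -> nat -> R).
Arguments H : clear implicits.

Definition aggregation_upper_bound : Prop :=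
  exists C : R, forall (M : nat) (ps : 'I_M -> Rd R d -> R), in_L2 ps ->
    exists T : forall n, n.-tuple (Rd R d) -> Rd R d -> R,
    forall n, adm M n ->
      is_estimator (T n) /\ max_excess_risk P (H M) ps (T n) <= (C * psi n M)%:E.

Definition aggregation_lower_bound : Prop :=
  exists2 c : R, (0 < c)%R & forall M : nat,
    exists2 ps : 'I_M -> Rd R d -> R, in_L2 ps &
    forall n, adm M n -> forall T : n.-tuple (Rd R d) -> Rd R d -> R,
      is_estimator T -> (c * psi n M)%:E <= max_excess_risk P (H M) ps T.

Definition optimal_aggregation_rate : Prop :=
  [/\ (forall M n, adm M n -> 0 < psi n M)%R,
      aggregation_upper_bound & aggregation_lower_bound].

(* An aggregate is given by the estimators [agg M ps n] which are versions of
   it (e.g. because minimizers need not be unique): there has to be at least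
   one, and the bound has to hold for all of them with the same constant. *)
Definition rate_optimal_aggregate
    (agg : forall M, ('I_M -> Rd R d -> R) ->
           forall n, set (n.-tuple (Rd R d) -> Rd R d -> R)) : Prop :=
  aggregation_lower_bound /\
  exists C : R, forall (M : nat) (ps : 'I_M -> Rd R d -> R), in_L2 ps ->
    forall n, adm M n ->
      [/\ (exists T, agg M ps n T),
          (forall T, agg M ps n T -> is_estimator T) &
          forall T, agg M ps n T ->
            max_excess_risk P (H M) ps T <= (C * psi n M)%:E].

End rates.

Definition aggregation_criterion (M : nat) (ps : 'I_M -> Rd R d -> R)
    (n : nat) (x : n.-tuple (Rd R d)) (lam : M.-tuple R) : \bar R :=
  L2norm (mixture ps lam) ^+ 2
  - (2 / n%:R * \sum_(i < n) mixture ps lam (tnth x i))%:E.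

Definition minimizing_aggregate (H : forall M, set (M.-tuple R)) (M : nat)
    (ps : 'I_M -> Rd R d -> R) (n : nat) :
    set (n.-tuple (Rd R d) -> Rd R d -> R) :=
  [set T | is_estimator T /\
    exists lamhat : n.-tuple (Rd R d) -> M.-tuple R,
      forall x, [/\ H M (lamhat x),
        (forall lam, H M lam -> aggregation_criterion ps x (lamhat x)
                                <= aggregation_criterion ps x lam) &
        T x = mixture ps (lamhat x)]].

End aggregation.

Arguments bounded_densities : clear implicits.

Definition subsimplex (R : realType) (M : nat) : set (M.-tuple R) :=
  [set lam | (forall j, 0 <= tnth lam j) /\ \sum_(j < M) tnth lam j <= 1].
Arguments subsimplex : clear implicits.

Definition convex_aggregate (R : realType) (d : nat) :=
  @minimizing_aggregate R d (subsimplex R).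
Arguments convex_aggregate : clear implicits.

(* Main.v *)
Require Import Defs.
From HB Require Import structures.
From mathcomp Require Import all_boot all_order all_algebra.
From mathcomp Require Import all_classical all_reals all_analysis.
From mathcomp Require Import measurable_realfun ess_sup_inf ring lra.

Set Implicit Arguments.
Unset Strict Implicit.
Unset Printing Implicit Defensive.

Import Order.TTheory GRing.Theory Num.Theory.
Import numFieldNormedType.Exports.

Local Open Scope classical_set_scope.
Local Open Scope ring_scope.

(** Upper bound. Write [G] for the Gram matrix of the [p_j], [m_j = <p_j, p>] and
    [b_j] for the empirical mean of [p_j]. The first-order condition for the
    minimizer [lh] of [l.G.l - 2 b.l] over the simplex gives, for every
    competitor [l] and with [a = l - lh],
    [|p_lh - p|^2 <= |p_l - p|^2 + 2 (m - b).a - a.G.a].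
    For [S = G + e I] the last two terms are at most
    [(b - m).S^-1.(b - m) + e |a|^2], and since [p <= L] the expectation of the
    quadratic form is at most [(L / n) tr (S^-1 G) <= L M / n]; let [e -> 0].
    The regularization by [e] dispenses with any independence assumption on the
    [p_j].

    A minimizer depending measurably on the sample is obtained as the limit of
    minimizers over finitely many points of a dense sequence, along a subsequence
    that itself depends measurably on the sample.

    Lower bound. Assouad's lemma for the densities
    [(L / 2) (1 + sum_j w_j e phi_j)], where the [phi_j] are Haar-like functions
    with values [1] and [-1] on two cells of volume [1 / (L (M - 1))], the bits
    [w_j] are in [{0, 1}] and [e^2] is of order [M / n]. They all belong to the
    convex hull, so that the oracle risk vanishes, and two of them differing in
    one bit have chi-square divergence [e^2 / (M - 1)], of order [1 / n]. *)

(** * Samples and iterated integrals *)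

Section tonelli.
Context (dT : measure_display) (T : measurableType dT) (R : realType).
Variable mu : {sigma_finite_measure set T -> \bar R}.
Local Open Scope ereal_scope.

Lemma ge0_integral_tuple_measureS (n : nat) (f : n.+1.-tuple T -> \bar R) :
  measurable_fun setT f -> (forall t, 0 <= f t) ->
  \int[tuple_measure mu n.+1]_t f t =
  \int[mu]_y \int[tuple_measure mu n]_t f (tuple_cons (y, t)).
Proof.
move=> mf f0.
rewrite (@ge0_integral_pushforward _ _ _ _ _ (@tuple_cons _ T n)
  (@measurable_tuple_cons _ T n) (mu \x tuple_measure mu n) setT f)//.
rewrite preimage_setT fubini_tonelli1//; last by move=> z; exact: f0.
exact: measurableT_comp mf (@measurable_tuple_cons _ T n).
Qed.

Lemma measurable_fun_consr (n : nat) (y : T) :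
  measurable_fun setT (fun t : n.-tuple T => tuple_cons (y, t)).
Proof. exact: (@measurable_cons _ _ _ _ (cst y) n id). Qed.

End tonelli.

Section density_lemmas.
Context (R : realType) (d : nat).
Local Open Scope ereal_scope.

Lemma sqr_L2norm (f : Rd R d -> R) :
  L2norm f ^+ 2 = \int[leb R d]_x ((f x) ^+ 2)%:E.
Proof.
rewrite expe2 -[X in X * _]poweRe1 ?Lnorm_ge0// -[X in _ * X]poweRe1 ?Lnorm_ge0//.
rewrite -poweRD ?add_neq0_poweRD_def// -[(1 + 1)%R]/(2%:R) poweR_Lnorm//.
apply: eq_integral => x _ /=.
by rewrite -[2%R]/(2%:R)%R powR_mulrn// real_normK// num_real.
Qed.

Lemma measurable_prod_tnth (n : nat) (p : Rd R d -> R) :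
  measurable_fun setT p ->
  measurable_fun setT (fun t : n.-tuple (Rd R d) => \prod_(i < n) p (tnth t i))%R.
Proof.
move=> mp; apply: measurable_prod => i _.
exact: measurableT_comp mp (measurable_tnth i).
Qed.

(** Tonelli's theorem isolates the first observation. The inductions on the sample size below all
    use this recursion. *)
Lemma sample_expectationS (n : nat) (p : Rd R d -> R)
    (f : n.+1.-tuple (Rd R d) -> \bar R) :
  measurable_fun setT p -> (forall y, 0 <= p y)%R ->
  measurable_fun setT f -> (forall t, 0 <= f t) ->
  sample_expectation p f =
  \int[leb R d]_y ((p y)%:E *
    sample_expectation p (fun t : n.-tuple (Rd R d) => f (tuple_cons (y, t)))).
Proof.
move=> mp p0 mf f0; rewrite /sample_expectation.
have mP k : measurable_fun setT
    (fun t : k.-tuple (Rd R d) => (\prod_(i < k) p (tnth t i))%:E).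
  by apply/measurable_EFinP; exact: measurable_prod_tnth.
have P0 k (t : k.-tuple (Rd R d)) : 0 <= (\prod_(i < k) p (tnth t i))%:E.
  by rewrite lee_fin prodr_ge0.
rewrite ge0_integral_tuple_measureS; last 2 first.
- by apply: emeasurable_funM; [exact: mP|exact: mf].
- by move=> t; apply: mule_ge0; [exact: P0|exact: f0].
apply: eq_integral => y _.
rewrite -ge0_integralZl//; last 3 first.
- apply: emeasurable_funM; first exact: mP.
  exact: measurableT_comp mf (@measurable_fun_consr _ _ n y).
- by move=> t _; apply: mule_ge0; [exact: P0|exact: f0].
- by rewrite lee_fin.
apply: eq_integral => t _; rewrite big_ord_recl EFinM -muleA; congr (_ * _).
by congr ((_)%:E * _); apply: eq_bigr => i _; rewrite tnthS.
Qed.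

Lemma sample_expectation0 (p : Rd R d -> R) (f : 0.-tuple (Rd R d) -> \bar R) :
  measurable_fun setT f -> sample_expectation p f = f [tuple].
Proof.
move=> mf; rewrite /sample_expectation integral_dirac//.
  by rewrite diracT mul1e big_ord0 mul1e.
apply: emeasurable_funM => //.
by under eq_fun do rewrite big_ord0; exact: measurable_cst.
Qed.

Lemma ge0_le_sample_expectation (n : nat) (p : Rd R d -> R)
    (f g : n.-tuple (Rd R d) -> \bar R) :
  measurable_fun setT p -> (forall y, 0 <= p y)%R ->
  measurable_fun setT f -> (forall t, 0 <= f t) ->
  measurable_fun setT g -> (forall t, f t <= g t) ->
  sample_expectation p f <= sample_expectation p g.
Proof.
move=> mp p0 mf f0 mg fg; rewrite /sample_expectation.
have mP : measurable_fun setT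
    (fun t : n.-tuple (Rd R d) => (\prod_(i < n) p (tnth t i))%:E).
  by apply/measurable_EFinP; exact: measurable_prod_tnth.
have P0 (t : n.-tuple (Rd R d)) : 0 <= (\prod_(i < n) p (tnth t i))%:E.
  by rewrite lee_fin prodr_ge0.
apply: ge0_le_integral => //.
- by move=> t _; exact: mule_ge0.
- exact: emeasurable_funM.
- exact: emeasurable_funM.
- by move=> t _; exact: lee_wpmul2l.
Qed.

(** Independence as a product formula. Besides densities it serves for ratios [q^2 / p], where it
    yields the chi-square moment of the whole sample. *)
Lemma ge0_integral_prod_tnth (n : nat) (g : Rd R d -> R) (c : R) :
  measurable_fun setT g -> (forall y, 0 <= g y)%R ->
  \int[leb R d]_y (g y)%:E = c%:E ->
  \int[tuple_measure (leb R d) n]_t (\prod_(i < n) g (tnth t i))%:E =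
  (c ^+ n)%:E.
Proof.
move=> mg g0 gc.
have c0 : 0 <= c%:E.
  by rewrite -gc; apply: integral_ge0 => y _; rewrite lee_fin.
(* Read as the expectation of the constant 1, the integral obeys the recursion on the sample
   size. *)
transitivity (sample_expectation g (fun _ : n.-tuple (Rd R d) => 1)).
  by apply: eq_integral => t _; rewrite mule1.
elim: n => [|n IHn]; first by rewrite sample_expectation0// expr0.
rewrite sample_expectationS// exprS.
under eq_integral do rewrite IHn.
rewrite ge0_integralZr//.
- by rewrite gc.
- by apply/measurable_EFinP.
- by move=> y _; rewrite lee_fin.
- by rewrite lee_fin exprn_ge0.
Qed.

End density_lemmas.

(** * Quadratic forms *)

Section bilinear.
Context (R : realType) (M : nat).
Implicit Types (A G : 'M[R]_M) (u v w a b l : 'rV[R]_M).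

(** Vectors are rows; [bil 1%:M] plays the role of the Euclidean inner product throughout. *)
Definition bil A u v : R := (u *m A *m v^T) 0 0.

Lemma bilE A u v : bil A u v = \sum_i \sum_j A i j * (u 0 i * v 0 j).
Proof.
rewrite /bil mxE exchange_big; apply: eq_bigr => j _.
rewrite !mxE mulr_suml; apply: eq_bigr => i _.
by rewrite mulrCA mulrA.
Qed.

Lemma bil1E u v : bil 1%:M u v = \sum_j u 0 j * v 0 j.
Proof. by rewrite /bil mulmx1 mxE; apply: eq_bigr => j _; rewrite mxE. Qed.

Lemma bilDl A u v w : bil A (u + v) w = bil A u w + bil A v w.
Proof. by rewrite /bil !mulmxDl mxE. Qed.

Lemma bilDr A u v w : bil A w (u + v) = bil A w u + bil A w v.
Proof. by rewrite /bil linearD mulmxDr mxE. Qed.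

Lemma bilNl A u v : bil A (- u) v = - bil A u v.
Proof. by rewrite /bil !mulNmx mxE. Qed.

Lemma bilNr A u v : bil A u (- v) = - bil A u v.
Proof. by rewrite /bil linearN mulmxN mxE. Qed.

Lemma bil0l A u : bil A 0 u = 0.
Proof. by rewrite /bil !mul0mx mxE. Qed.

Lemma bilZl A (t : R) u v : bil A (t *: u) v = t * bil A u v.
Proof. by rewrite /bil -!scalemxAl mxE. Qed.

Lemma bilZr A (t : R) u v : bil A u (t *: v) = t * bil A u v.
Proof. by rewrite /bil linearZ -scalemxAr mxE. Qed.

Lemma bilC A u v : A^T = A -> bil A u v = bil A v u.
Proof.
move=> As; rewrite /bil -[in LHS](trmxK (u *m A *m v^T)) mxE.
by rewrite !trmx_mul trmxK As mulmxA.
Qed.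

Lemma bilDA A G u v : bil (A + G) u v = bil A u v + bil G u v.
Proof. by rewrite /bil mulmxDr mulmxDl mxE. Qed.

Lemma bilZA A (t : R) u v : bil (t *: A) u v = t * bil A u v.
Proof. by rewrite /bil -scalemxAr -scalemxAl mxE. Qed.

Lemma bil1_ge0 u : 0 <= bil 1%:M u u.
Proof. by rewrite bil1E sumr_ge0// => j _; rewrite -expr2 sqr_ge0. Qed.

Lemma bil_delta A i : bil A (delta_mx 0 i) (delta_mx 0 i) = A i i.
Proof.
rewrite bilE (bigD1 i)//= (bigD1 i)//= !mxE !eqxx !mulr1 !big1 ?addr0// => j.
  by move=> ji; rewrite big1// => k _; rewrite !mxE (negbTE ji) mul0r mulr0.
by move=> ji; rewrite !mxE (negbTE ji) !mulr0.
Qed.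

(* Only the first-order condition at the minimizer [lh] is used, so the
   comparison point [lh + a] need not be optimal for [m]. *)
Lemma bil_argmin_le G b m lh a : G^T = G ->
  (forall t, 0 <= t <= 1 ->
    bil G lh lh - 2 * bil 1%:M b lh <=
    bil G (lh + t *: a) (lh + t *: a) - 2 * bil 1%:M b (lh + t *: a)) ->
  bil G lh lh - 2 * bil 1%:M m lh <=
  bil G (lh + a) (lh + a) - 2 * bil 1%:M m (lh + a) +
  (2 * bil 1%:M (m - b) a - bil G a a).
Proof.
move=> Gs min.
rewrite !bilDl !bilDr !bilNl (bilC lh a)//.
set x := bil G a lh; set y := bil G a a; set z := bil _ b a.
(* Moving from [lh] by [t *: a] changes the criterion by [t (2 (x - z) + t y)], so [z <= x] is the
   first-order condition at the minimizer. *)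
suff : z <= x by lra.
have {}min t : 0 <= t <= 1 -> 0 <= t * (2 * (x - z) + t * y).
  move=> /min; rewrite !bilDl !bilDr !bilZl !bilZr (bilC lh a)// -/x -/y -/z.
  by move=> ?; nra.
rewrite leNgt; apply/negP => xz.
(* If [x < z], the step [t = (z - x) / y] makes the criterion decrease; when [y] is not positive or
   this step exceeds 1, the full step [t = 1] does. *)
have [y0|y0] := leP y (z - x).
  by have := min 1 ltac:(lra); nra.
have yp : 0 < y by lra.
have := min ((z - x) / y).
rewrite divfK ?gt_eqF// => H.
have : 0 <= (z - x) / y <= 1.
  by rewrite divr_ge0 ?ler_pdivrMr ?mul1r//; lra.
move=> /H; apply/negP; rewrite -ltNge nmulr_llt0; last by lra.
by rewrite divr_gt0//; lra.
Qed.

(** * Inverse and trace of the regularized Gram matrix *)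

Section regularized_gram.
Variables (G : 'M[R]_M) (e : R).
Hypotheses (Gs : G^T = G) (Gpsd : forall u, 0 <= bil G u u) (e0 : 0 < e).

Let S := G + e *: 1%:M.

Lemma reg_gramE u v : bil S u v = bil G u v + e * bil 1%:M u v.
Proof. by rewrite bilDA bilZA. Qed.

Let Ss : S^T = S.
Proof. by rewrite linearD linearZ/= trmx1 Gs. Qed.

Lemma reg_gram_psd u : 0 <= bil S u u.
Proof. by rewrite reg_gramE addr_ge0// mulr_ge0 ?bil1_ge0// ltW. Qed.

(** A row [u] of the kernel satisfies [u.S.u = 0]. Both summands [u.G.u] and [e |u|^2] are
    nonnegative, hence [|u|^2 = 0]. *)
Lemma reg_gram_unit : S \in unitmx.
Proof.
rewrite -row_free_unit -kermx_eq0; apply/eqP/row_matrixP => i; rewrite row0.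
set u := row i _.
have uS : u *m S = 0 by rewrite -row_mul mulmx_ker row0.
have : bil S u u = 0 by rewrite /bil uS mul0mx mxE.
rewrite reg_gramE => /eqP; rewrite paddr_eq0 ?Gpsd ?mulr_ge0 ?bil1_ge0 ?ltW//.
move=> /andP[_]; rewrite mulf_eq0 gt_eqF//= bil1E psumr_eq0; last first.
  by move=> j _; rewrite -expr2 sqr_ge0.
move=> /allP uj; apply/rowP => j; rewrite [RHS]mxE.
by apply/eqP; have := uj j (mem_index_enum j); rewrite mulf_eq0 orbb.
Qed.

Lemma inv_reg_gram_sym : (invmx S)^T = invmx S.
Proof. by rewrite trmx_inv Ss. Qed.

Lemma bil_inv_reg_gram u v : bil S (u *m invmx S) v = bil 1%:M u v.
Proof. by rewrite /bil mulmxKV ?reg_gram_unit// mulmx1. Qed.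

Lemma inv_reg_gram_psd u : 0 <= bil (invmx S) u u.
Proof.
have -> : bil (invmx S) u u = bil S (u *m invmx S) (u *m invmx S).
  by rewrite bil_inv_reg_gram /bil mulmx1 trmx_mul inv_reg_gram_sym mulmxA.
exact: reg_gram_psd.
Qed.

(* Expand [0 <= (a - w S^-1) S (a - w S^-1)^T]. *)
Lemma bil_reg_gram_le w a : 2 * bil 1%:M w a - bil G a a <=
  bil (invmx S) w w + e * bil 1%:M a a.
Proof.
have := reg_gram_psd (a - w *m invmx S).
rewrite !bilDl !bilDr !bilNl !bilNr (bilC _ (w *m invmx S))//.
rewrite !bil_inv_reg_gram reg_gramE.
have -> : bil 1%:M w (w *m invmx S) = bil (invmx S) w w.
  by rewrite /bil mulmx1 trmx_mul inv_reg_gram_sym mulmxA.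
lra.
Qed.

(** The left side is [tr (S^-1 G) = M - e tr (S^-1)], and the diagonal of [S^-1] is nonnegative. *)
Lemma inv_reg_gram_trace : \sum_i \sum_j invmx S i j * G i j <= M%:R.
Proof.
have -> : \sum_i \sum_j invmx S i j * G i j = \tr (invmx S *m G).
  apply: eq_bigr => i _; rewrite mxE; apply: eq_bigr => j _.
  by rewrite -[in RHS]Gs mxE.
have -> : G = S - e *: 1%:M by rewrite addrK.
rewrite mulmxBr mulVmx ?reg_gram_unit// -scalemxAr mulmx1.
rewrite linearB/= linearZ/= mxtrace1 lerBlDr lerDl mulr_ge0 ?(ltW e0)//.
by apply: sumr_ge0 => i _; rewrite -bil_delta inv_reg_gram_psd.
Qed.

End regularized_gram.

End bilinear.

(** * Moments of quadratic forms of the sample *)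

Section has_integral.
Context d (T : measurableType d) (R : realType) (mu : {measure set T -> \bar R}).
Implicit Types (f g : T -> R) (r s : R).

(** Integrability and the value are kept together, so that both pass through linear combinations at
    once. *)
Definition has_integral f r :=
  mu.-integrable setT (EFin \o f) /\ (\int[mu]_x (f x)%:E = r%:E)%E.

Lemma has_integral_fine f : mu.-integrable setT (EFin \o f) ->
  has_integral f (\int[mu]_x f x).
Proof.
by move=> fi; split=> //; rewrite /Rintegral fineK//; exact: integrable_fin_num.
Qed.

Lemma eq_has_integral f g r : f =1 g -> has_integral g r -> has_integral f r.
Proof. by move=> /funext ->. Qed.

Lemma has_integral0 : has_integral (fun=> 0) 0.
Proof. by split; [exact: integrable0|rewrite integral0]. Qed.

Lemma has_integralD f g r s : has_integral f r -> has_integral g s ->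
  has_integral (fun x => f x + g x) (r + s).
Proof.
move=> [fi fr] [gi gs]; split; first exact: (integrableD _ fi gi).
by under eq_integral do rewrite EFinD; rewrite integralD_EFin// fr gs.
Qed.

Lemma has_integralZ (k : R) f r : has_integral f r ->
  has_integral (fun x => k * f x) (k * r).
Proof.
move=> [fi fr]; split; first exact: (integrableZl _ _ fi).
by under eq_integral do rewrite EFinM; rewrite integralZl// fr.
Qed.

Lemma has_integralB f g r s : has_integral f r -> has_integral g s ->
  has_integral (fun x => f x - g x) (r - s).
Proof.
move=> fr gs; have := has_integralD fr (has_integralZ (-1) gs).
by rewrite mulN1r; apply: eq_has_integral => x; rewrite mulN1r.
Qed.

Lemma has_integral_sum (I : Type) (q : seq I) (f : I -> T -> R) (r : I -> R) :
  (forall i, has_integral (f i) (r i)) ->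
  has_integral (fun x => \sum_(i <- q) f i x) (\sum_(i <- q) r i).
Proof.
move=> fr; elim: q => [|i q IH].
  by rewrite big_nil; apply: eq_has_integral has_integral0 => x; rewrite big_nil.
rewrite big_cons; apply: eq_has_integral (has_integralD (fr i) IH) => x.
by rewrite big_cons.
Qed.

End has_integral.

Section moments.
Context (R : realType) (d M : nat) (ps : 'I_M -> Rd R d -> R).
Local Notation mu := (leb R d).

Definition prow (y : Rd R d) : 'rV[R]_M := \row_j ps j y.

Lemma has_integral_bil (w : Rd R d -> R) (G A : 'M[R]_M) :
  (forall i j, has_integral mu (fun y => w y * (ps i y * ps j y)) (G i j)) ->
  has_integral mu (fun y => w y * bil A (prow y) (prow y))
    (\sum_i \sum_j A i j * G i j).
Proof.
move=> H.
apply: (eq_has_integral (g := fun y =>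
    \sum_i \sum_j A i j * (w y * (ps i y * ps j y)))).
  move=> y; rewrite bilE mulr_sumr; apply: eq_bigr => i _.
  rewrite mulr_sumr; apply: eq_bigr => j _.
  by rewrite !mxE mulrCA.
by apply: has_integral_sum => i; apply: has_integral_sum => j; exact: has_integralZ.
Qed.

Lemma has_integral_bilr (w : Rd R d -> R) (m u : 'rV[R]_M) (A : 'M[R]_M) :
  (forall j, has_integral mu (fun y => w y * ps j y) (m 0 j)) ->
  has_integral mu (fun y => w y * bil A u (prow y)) (bil A u m).
Proof.
move=> H; rewrite bilE.
apply: (eq_has_integral (g := fun y =>
    \sum_i \sum_j (A i j * u 0 i) * (w y * ps j y))).
  move=> y; rewrite bilE mulr_sumr; apply: eq_bigr => i _.
  by rewrite mulr_sumr; apply: eq_bigr => j _; rewrite !mxE; ring.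
apply: has_integral_sum => i; apply: has_integral_sum => j.
by rewrite mulrA; exact: has_integralZ.
Qed.

Lemma has_integral_bil_shift (p : Rd R d -> R) (m u : 'rV[R]_M) (A G : 'M[R]_M)
    (c : R) : A^T = A -> has_integral mu p 1 ->
  (forall j, has_integral mu (fun y => p y * ps j y) (m 0 j)) ->
  (forall i j, has_integral mu (fun y => p y * (ps i y * ps j y)) (G i j)) ->
  has_integral mu (fun y => p y * (c + bil A (u + prow y) (u + prow y)))
    (c + bil A u u + 2 * bil A u m + \sum_i \sum_j A i j * G i j).
Proof.
move=> As p1 pm pG.
apply: (eq_has_integral (g := fun y => ((c + bil A u u) * p y +
    2 * (p y * bil A u (prow y))) + p y * bil A (prow y) (prow y))).
  by move=> y; rewrite !bilDl !bilDr (bilC (prow y) u)//; ring.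
apply: has_integralD; last exact: has_integral_bil.
apply: has_integralD; last by apply: has_integralZ; exact: has_integral_bilr.
by rewrite -[X in has_integral _ _ X]mulr1; exact: has_integralZ.
Qed.

Section expectation.
Variables (p : Rd R d -> R) (m : 'rV[R]_M) (A G : 'M[R]_M).
Hypotheses (mp : measurable_fun setT p) (p0 : forall y, 0 <= p y).
Hypotheses (p1 : has_integral (leb R d) p 1).
Hypothesis mps : forall j, measurable_fun setT (ps j).
Hypotheses (As : A^T = A) (Apsd : forall u, 0 <= bil A u u).
Hypothesis pm : forall j, has_integral mu (fun y => p y * ps j y) (m 0 j).
Hypothesis pG :
  forall i j, has_integral mu (fun y => p y * (ps i y * ps j y)) (G i j).

(** The trace of [A] times the covariance matrix of [prow ps X], where [X] has density [p]. *)
Let V := \sum_i \sum_j A i j * G i j - bil A m m.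

Lemma measurable_bil_sum (n : nat) (u : 'rV[R]_M) (c : R) :
  measurable_fun setT (fun x : n.-tuple (Rd R d) =>
    let v := u + \sum_(k < n) (prow (tnth x k) - m) in c + bil A v v).
Proof.
have mv i : measurable_fun setT (fun x : n.-tuple (Rd R d) =>
    (u + \sum_(k < n) (prow (tnth x k) - m)) 0 i).
  rewrite (_ : (fun _ => _) = (fun x : n.-tuple (Rd R d) =>
      u 0 i + \sum_(k < n) (ps i (tnth x k) - m 0 i))).
    apply: measurable_funD => //; apply: measurable_sum => k.
    apply: measurable_funB => //.
    exact: measurableT_comp (mps i) (measurable_tnth k).
  apply/funext => x; rewrite mxE summxE; congr (_ + _).
  by apply: eq_bigr => k _; rewrite !mxE.
apply: measurable_funD => //.
under eq_fun do rewrite bilE.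
apply: measurable_sum => i; apply: measurable_sum => j.
by apply: measurable_funM => //; exact: measurable_funM.
Qed.

(** The increments are independent and centred: cross terms vanish and each observation contributes
    [V]. The starting point [u] is arbitrary because the induction absorbs the first observation
    into it; [0 <= c] keeps the integrand nonnegative for Tonelli's theorem. *)
Lemma sample_expectation_bil (n : nat) (u : 'rV[R]_M) (c : R) : 0 <= c ->
  sample_expectation p (fun x : n.-tuple (Rd R d) =>
    let v := u + \sum_(k < n) (prow (tnth x k) - m) in (c + bil A v v)%:E) =
  (c + bil A u u + n%:R * V)%:E.
Proof.
elim: n u c => [|n IHn] u c c0.
  rewrite sample_expectation0.
    by rewrite big_ord0 addr0 mul0r addr0.
  by apply/measurable_EFinP; exact: measurable_bil_sum.
rewrite sample_expectationS//; last 2 first.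
- by apply/measurable_EFinP; exact: measurable_bil_sum.
- by move=> x; rewrite lee_fin addr_ge0.
have step y : sample_expectation p (fun t : n.-tuple (Rd R d) =>
     let v := u + \sum_(k < n.+1) (prow (tnth (tuple_cons (y, t)) k) - m) in
     (c + bil A v v)%:E) =
   (c + n%:R * V + bil A (u - m + prow y) (u - m + prow y))%:E.
  rewrite addrAC -IHn//; congr (sample_expectation _ _); apply/funext => t /=.
  rewrite big_ord_recl tnth0 addrA -(addrA u (- m)) (addrC (- m)).
  congr (_ + bil A (_ + _) (_ + _))%:E;
    by apply: eq_bigr => k _; rewrite /tuple_cons tnthS.
under eq_integral do rewrite step -EFinM.
have [_ ->] := has_integral_bil_shift (u - m) (c + n%:R * V) As p1 pm pG.
congr EFin; rewrite !bilDl !bilDr !bilNl !bilNr (bilC m u)// /V -natr1; ring.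
Qed.

End expectation.

End moments.

(** * Gram matrix and moments under a bounded density *)

Section ae_domination.
Context d (T : measurableType d) (R : realType) (mu : {measure set T -> \bar R}).
Local Open Scope ereal_scope.

Lemma ae_le_integrable (f g : T -> R) : measurable_fun setT f ->
  mu.-integrable setT (EFin \o g) ->
  {ae mu, forall x, (`|f x| <= `|g x|)%R} -> mu.-integrable setT (EFin \o f).
Proof.
move=> mf /integrableP[mg goo] fg; apply/integrableP; split.
  exact/measurable_EFinP.
apply: le_lt_trans goo; apply: ae_ge0_le_integral => //=.
- by do 2 apply: measurableT_comp => //.
- apply/measurable_EFinP; apply: measurableT_comp => //.
  exact/measurable_EFinP.
- by apply: filterS fg => x fgx _; rewrite lee_fin.
Qed.

Lemma measurable_sqr_Lfun2 (f : T -> R) : measurable_fun setT f ->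
  \int[mu]_x (f x ^+ 2)%:E < +oo -> f \in Lfun mu 2%:E.
Proof.
move=> mf f2; rewrite inE; apply/andP; split; rewrite inE//=.
rewrite /finite_norm unlock poweR_lty//=; apply: le_lt_trans f2.
rewrite (_ : \int[_]__ _ = \int[mu]_y (f y ^+ 2)%:E)//.
apply: eq_integral => y _ /=.
by rewrite -[2%R]/(2%:R)%R powR_mulrn// real_normK// num_real.
Qed.

End ae_domination.

Section gram.
Context (R : realType) (d M : nat) (ps : 'I_M -> Rd R d -> R).
Hypothesis psL2 : in_L2 ps.
Local Notation mu := (leb R d).

Lemma measurable_in_L2 (j : 'I_M) : measurable_fun setT (ps j).
Proof. by have /andP[/[!inE]] := psL2 j. Qed.

Definition gram : 'M[R]_M := \matrix_(i, j) \int[mu]_y (ps i y * ps j y).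

Lemma has_integral_gram i j :
  has_integral mu (fun y => ps i y * ps j y) (gram i j).
Proof.
rewrite mxE; apply: has_integral_fine.
by apply/Lfun1_integrable; exact: Lfun2_mul_Lfun1.
Qed.

Lemma gram_sym : gram^T = gram.
Proof.
by apply/matrixP => i j; rewrite !mxE; apply: eq_Rintegral => y _; rewrite mulrC.
Qed.

Definition trow (lam : M.-tuple R) : 'rV[R]_M := \row_j tnth lam j.

Lemma mixtureE lam y : mixture ps lam y = bil 1%:M (trow lam) (prow ps y).
Proof. by rewrite bil1E; apply: eq_bigr => j _; rewrite !mxE. Qed.

Lemma has_integral_bil_gram (A : 'M[R]_M) :
  has_integral mu (fun y => bil A (prow ps y) (prow ps y))
    (\sum_i \sum_j A i j * gram i j).
Proof.
apply: (eq_has_integral (g := fun y => 1 * bil A (prow ps y) (prow ps y))).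
  by move=> y; rewrite mul1r.
apply: has_integral_bil => i j.
by apply: (eq_has_integral _ (has_integral_gram i j)) => y; rewrite mul1r.
Qed.

(** The square of a linear form is the quadratic form of the rank-one matrix [u^T *m u]. *)
Lemma has_integral_lin_sqr (u : 'rV[R]_M) :
  has_integral mu (fun y => bil 1%:M u (prow ps y) ^+ 2) (bil gram u u).
Proof.
have -> : bil gram u u = \sum_i \sum_j (u^T *m u) i j * gram i j.
  rewrite bilE; apply: eq_bigr => i _; apply: eq_bigr => j _.
  by rewrite [in RHS]mulrC [(u^T *m u) i j]mxE big_ord1 [u^T i 0]mxE.
apply: (eq_has_integral _ (has_integral_bil_gram _)) => y.
set v := prow ps y.
rewrite /bil mulmx1 (_ : v *m _ *m v^T = (u *m v^T)^T *m (u *m v^T)).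
  by rewrite [RHS]mxE big_ord1 [X in _ = X * _]mxE expr2.
by rewrite trmx_mul trmxK !mulmxA.
Qed.

Lemma gram_psd u : 0 <= bil gram u u.
Proof.
have [_ H] := has_integral_lin_sqr u.
by rewrite -lee_fin -H; apply: integral_ge0 => y _; rewrite lee_fin sqr_ge0.
Qed.

(** Expansion of the square, used with [g = p] for the loss and with [g = 0] for the norm in the
    criterion. *)
Lemma sqr_L2norm_mixtureB (g : Rd R d -> R) (m : 'rV[R]_M) (g2 : R) lam :
  (forall j, has_integral mu (fun y => g y * ps j y) (m 0 j)) ->
  has_integral mu (fun y => g y ^+ 2) g2 ->
  (L2norm (mixture ps lam \- g)%R ^+ 2 =
  (bil gram (trow lam) (trow lam) - 2 * bil 1%:M m (trow lam) + g2)%:E)%E.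
Proof.
move=> gm gg; rewrite sqr_L2norm.
rewrite (bilC m) ?trmx1//.
set u := trow lam.
have [_ <-] : has_integral mu (fun y => bil 1%:M u (prow ps y) ^+ 2 -
    2 * (g y * bil 1%:M u (prow ps y)) + g y ^+ 2)
    (bil gram u u - 2 * bil 1%:M u m + g2).
  apply: has_integralD => //; apply: has_integralB.
    exact: has_integral_lin_sqr.
  by apply: has_integralZ; exact: has_integral_bilr.
by apply: eq_integral => y _; rewrite /= mixtureE -/u; congr EFin; ring.
Qed.

Lemma sqr_L2norm_mixture lam :
  (L2norm (mixture ps lam) ^+ 2 = (bil gram (trow lam) (trow lam))%:E)%E.
Proof.
rewrite (_ : mixture ps lam = mixture ps lam \- cst 0); last first.
  by apply/funext => y; rewrite /= subr0.
rewrite (sqr_L2norm_mixtureB (m := 0) (g2 := 0)).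
- by rewrite bil0l mulr0 subr0 addr0.
- move=> j; rewrite mxE; apply: eq_has_integral (has_integral0 _) => y.
  by rewrite mul0r.
- by apply: eq_has_integral (has_integral0 _) => y; rewrite expr0n.
Qed.

Definition sample_mean (n : nat) (x : n.-tuple (Rd R d)) : 'rV[R]_M :=
  n%:R^-1 *: \sum_(k < n) prow ps (tnth x k).

(** This is the expanded loss without its constant term and with the mean vector replaced by the
    sample mean, which is the form [bil_argmin_le] compares. *)
Lemma aggregation_criterionE (n : nat) (x : n.-tuple (Rd R d)) lam :
  aggregation_criterion ps x lam =
  (bil gram (trow lam) (trow lam) -
   2 * bil 1%:M (sample_mean x) (trow lam))%:E.
Proof.
rewrite /aggregation_criterion sqr_L2norm_mixture; congr (_ - _%:E)%E.
rewrite bilZl mulrA; congr (_ * _).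
have -> : bil 1%:M (\sum_(k < n) prow ps (tnth x k)) (trow lam) =
    \sum_(k < n) bil 1%:M (prow ps (tnth x k)) (trow lam).
  elim/big_rec2 : _ => [|k y1 y2 _ <-]; last by rewrite bilDl.
  by rewrite bil0l.
by apply: eq_bigr => k _; rewrite mixtureE (bilC _ (trow lam)) ?trmx1.
Qed.

End gram.

Section density_moments.
Context (R : realType) (d M : nat) (ps : 'I_M -> Rd R d -> R) (L : R).
Hypotheses (psL2 : in_L2 ps) (L0 : 0 < L).
Variable p : Rd R d -> R.
Hypothesis pP : bounded_densities R d L p.
Local Notation mu := (leb R d).

Let mp : measurable_fun setT p. Proof. by case: pP => -[]. Qed.
Let p0 y : 0 <= p y. Proof. by case: pP => -[]. Qed.

Lemma density_has_integral : has_integral mu p 1.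
Proof.
have [[_ _ p1] _] := pP; split => //; apply/integrableP; split.
  exact/measurable_EFinP.
rewrite (_ : (\int[_]__ _ = 1)%E) ?ltry// -p1.
by apply: eq_integral => y _ /=; rewrite ger0_norm.
Qed.

Lemma density_ae_le : {ae mu, forall y, p y <= L}.
Proof.
have [[_ _ p1] +] := pP; rewrite unlock; case: ifPn => [_ /ess_supP|].
  by apply: filterS => y /=; rewrite lee_fin ger0_norm.
(* For a null measure the L_infinity norm is 0 by convention and carries no information, but then
   [p] could not have integral one. *)
rewrite -leNgt => muT; exfalso.
suff : (\int[mu]_x (p x)%:E = 0)%E by rewrite p1 => /eqP; rewrite onee_eq0.
apply/null_set_integral => //; last by apply/eqP; rewrite eq_le muT measure_ge0.
exact/measurable_EFinP.
Qed.

(** Almost everywhere [p^2 <= L p], and [p] has integral one. *)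
Lemma density_in_L2 : p \in Lfun mu 2%:E.
Proof.
apply: measurable_sqr_Lfun2 => //.
apply: (@le_lt_trans _ _ (\int[mu]_y (L%:E * (p y)%:E))%E).
  apply: ae_ge0_le_integral => //.
  - by move=> y _; rewrite lee_fin sqr_ge0.
  - by apply/measurable_EFinP; exact: measurable_funX.
  - by move=> y _; rewrite mule_ge0 ?lee_fin// ltW.
  - by apply: measurable_funeM; exact/measurable_EFinP.
  - apply: filterS density_ae_le => y py _.
    by rewrite lee_fin expr2 ler_wpM2r.
have [pi pe] := density_has_integral.
by rewrite integralZl// pe mule1 ltry.
Qed.

Lemma has_integral_density_mul j :
  has_integral mu (fun y => p y * ps j y) (\int[mu]_y (p y * ps j y)).
Proof.
apply: has_integral_fine; apply/Lfun1_integrable.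
by apply: Lfun2_mul_Lfun1; [exact: density_in_L2|exact: psL2].
Qed.

Lemma has_integral_density_sqr :
  has_integral mu (fun y => p y ^+ 2) (\int[mu]_y (p y ^+ 2)).
Proof.
apply: has_integral_fine; apply: Lfun2_integrable_sqr; exact: density_in_L2.
Qed.

Lemma has_integral_density_mul2 i j :
  has_integral mu (fun y => p y * (ps i y * ps j y))
    (\int[mu]_y (p y * (ps i y * ps j y))).
Proof.
apply: has_integral_fine.
apply: (ae_le_integrable (g := fun y => L * (ps i y * ps j y))).
- apply: measurable_funM => //.
  by apply: measurable_funM; exact: measurable_in_L2.
- by have [+ _] := has_integral_gram psL2 i j => /(integrableZl _ L); apply.
- apply: filterS density_ae_le => y py.
  by rewrite normrM [leRHS]normrM ler_wpM2r// ger0_norm// gtr0_norm.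
Qed.

(** Both sides integrate the nonnegative function [bil A] of [prow ps y], with weight [p] on the
    left and [L] on the right. This brings the factor [L] into the rate. *)
Lemma density_trace_le (A G : 'M[R]_M) : (forall u, 0 <= bil A u u) ->
  (forall i j, has_integral mu (fun y => p y * (ps i y * ps j y)) (G i j)) ->
  \sum_i \sum_j A i j * G i j <= L * \sum_i \sum_j A i j * gram ps i j.
Proof.
move=> Apsd /(has_integral_bil A)[i1 e1].
have [i2 e2] := has_integralZ L (has_integral_bil_gram psL2 A).
rewrite -lee_fin -e1 -e2; apply: ae_ge0_le_integral => //.
- by move=> y _; rewrite lee_fin mulr_ge0.
- by case/integrableP : i1.
- by move=> y _; rewrite lee_fin mulr_ge0// ltW.
- by case/integrableP : i2.
- by apply: filterS density_ae_le => y py _; rewrite lee_fin ler_wpM2r.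
Qed.

End density_moments.

(** * Upper bound *)

Section convex_aggregate_bound.
Context (R : realType) (d M : nat) (ps : 'I_M -> Rd R d -> R) (L : R).
Hypotheses (psL2 : in_L2 ps) (L0 : 0 < L).
Local Notation mu := (leb R d).

Lemma subsimplex_le1 (lam : M.-tuple R) j : subsimplex R M lam ->
  0 <= tnth lam j <= 1.
Proof.
move=> [l0 l1]; rewrite l0/=; apply: le_trans l1.
by rewrite (bigD1 j)//= lerDl sumr_ge0.
Qed.

(** Each coordinate of the difference is at most 1 in absolute value. The crude bound is enough,
    since it gets multiplied by the regularization parameter. *)
Lemma subsimplex_diff_le (lam lam' : M.-tuple R) :
  subsimplex R M lam -> subsimplex R M lam' ->
  bil 1%:M (trow lam' - trow lam) (trow lam' - trow lam) <= M%:R.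
Proof.
move=> sl sl'; rewrite bil1E -[M in M%:R]card_ord -sumr_const.
apply: ler_sum => j _; rewrite !mxE.
have /andP[? ?] := subsimplex_le1 j sl; have /andP[? ?] := subsimplex_le1 j sl'.
nra.
Qed.

Lemma subsimplex_segment (lam lam' : M.-tuple R) t : 0 <= t <= 1 ->
  subsimplex R M lam -> subsimplex R M lam' ->
  exists2 lam'', subsimplex R M lam'' &
    trow lam'' = trow lam + t *: (trow lam' - trow lam).
Proof.
move=> /andP[t0 t1] [l0 l1] [l0' l1'].
exists [tuple tnth lam j + t * (tnth lam' j - tnth lam j) | j < M]; last first.
  by apply/rowP => j; rewrite !mxE tnth_mktuple.
split=> [j|].
  by rewrite tnth_mktuple; have := l0 j; have := l0' j; nra.
under eq_bigr do rewrite tnth_mktuple.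
by rewrite big_split/= -mulr_sumr sumrB; nra.
Qed.

Lemma measurable_risk_integrand (n : nat) (p : Rd R d -> R)
    (T : n.-tuple (Rd R d) -> Rd R d -> R) :
  measurable_fun setT p -> is_estimator T ->
  measurable_fun setT (fun x => L2norm (T x \- p)%R ^+ 2)%E.
Proof.
move=> mp mT; under eq_fun do rewrite sqr_L2norm.
apply: (@measurable_fun_fubini_tonelli_F _ _ _ _ _ (leb R d)
  (fun z : n.-tuple (Rd R d) * Rd R d => ((T z.1 z.2 - p z.2) ^+ 2)%:E)).
  apply/measurable_EFinP; apply: measurable_funX; apply: measurable_funB => //.
  exact: measurableT_comp.
by move=> z; rewrite lee_fin sqr_ge0.
Qed.

Lemma risk_le (n : nat) (T : n.-tuple (Rd R d) -> Rd R d -> R)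
    (p : Rd R d -> R) (lam : M.-tuple R) :
  (0 < n)%N -> convex_aggregate R d M ps n T -> bounded_densities R d L p ->
  subsimplex R M lam ->
  (risk T p <= L2norm (mixture ps lam \- p)%R ^+ 2 + (L * M%:R / n%:R)%:E)%E.
Proof.
move=> n0 [mT [lamhat lamhatP]] pP sl.
have [[mp p0 _] _] := pP.
have pM := has_integral_density_mul psL2 L0 pP.
have p2 := has_integral_density_sqr L0 pP.
pose m : 'rV[R]_M := \row_j \int[mu]_y (p y * ps j y).
have {}pM j : has_integral mu (fun y => p y * ps j y) (m 0 j) by rewrite mxE.
pose G2 : 'M[R]_M := \matrix_(i, j) \int[mu]_y (p y * (ps i y * ps j y)).
have pG i j : has_integral mu (fun y => p y * (ps i y * ps j y)) (G2 i j).
  by rewrite mxE; exact: (has_integral_density_mul2 psL2 L0 pP).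
have Gs := gram_sym ps; have Gpsd := gram_psd psL2.
have lossE lam' := sqr_L2norm_mixtureB psL2 lam' pM p2.
rewrite lossE -EFinD; set r := (X in X + _).
have r0 : 0 <= r by rewrite -lee_fin -lossE sqr_L2norm integral_ge0// => y _;
  rewrite lee_fin sqr_ge0.
apply/lee_addgt0Pr => e e0.
have nR : 0 < n%:R :> R by rewrite ltr0n.
(* Chosen so that the regularization costs at most [e' M <= e]; dividing by [M.+1] also covers
   [M = 0]. *)
pose e' := e / M.+1%:R.
have e'0 : 0 < e' by rewrite divr_gt0.
have e'M : e' * M%:R <= e.
  by rewrite /e' mulrAC ler_pdivrMr// ler_wpM2l ?ler_nat ?ltW.
pose S := gram ps + e' *: 1%:M.
(* The factor [n^-2] compensates for evaluating the form at the sum, not the mean, of the centred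
   observations. *)
pose A := (n%:R^-1 ^+ 2) *: invmx S.
have As : A^T = A by rewrite linearZ/= inv_reg_gram_sym.
have Apsd u : 0 <= bil A u u.
  by rewrite bilZA mulr_ge0 ?sqr_ge0// inv_reg_gram_psd.
have c0 : 0 <= r + e by rewrite addr_ge0// ltW.
(* The loss is dominated for each sample by a quadratic form whose expectation is known exactly.
   That expectation is bounded first, the domination is proved afterwards. *)
apply: (@le_trans _ _ (sample_expectation p (fun x : n.-tuple (Rd R d) =>
    let v := 0 + \sum_(k < n) (prow ps (tnth x k) - m) in
    ((r + e) + bil A v v)%:E))); last first.
  rewrite (sample_expectation_bil mp p0 (density_has_integral pP)
    (measurable_in_L2 psL2) As Apsd pM pG)//.
  rewrite -EFinD lee_fin bil0l addr0 addrAC lerD2r lerD2l.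
  have trA : \sum_i \sum_j A i j * G2 i j <= n%:R^-1 ^+ 2 * (L * M%:R).
    apply: le_trans (density_trace_le psL2 L0 pP Apsd pG) _.
    rewrite mulrCA ler_wpM2l ?(ltW L0)//.
    under eq_bigr do under eq_bigr do rewrite mxE -mulrA.
    under eq_bigr do rewrite -mulr_sumr.
    by rewrite -mulr_sumr ler_wpM2l ?sqr_ge0// inv_reg_gram_trace.
  (* The squared-mean part of the variance enters with a minus sign and is dropped. *)
  have := Apsd m; set q := bil A m m => q0.
  apply: (@le_trans _ _ (n%:R * (n%:R^-1 ^+ 2 * (L * M%:R)))).
    by rewrite ler_wpM2l ?ler0n//; lra.
  by rewrite expr2 !mulrA divff ?gt_eqF// mul1r -mulrA mulrC lexx.
apply: ge0_le_sample_expectation => //.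
- exact: measurable_risk_integrand.
- by move=> x; rewrite sqr_L2norm integral_ge0// => y _; rewrite lee_fin sqr_ge0.
- by apply/measurable_EFinP; apply: measurable_bil_sum; exact: measurable_in_L2.
move=> x; have [slh lhmin ->] := lamhatP x; rewrite lossE lee_fin.
set v := 0 + _; set lh := trow (lamhat x).
pose b := sample_mean ps x; pose a := trow lam - lh.
have -> : bil A v v = bil (invmx S) (m - b) (m - b).
  have -> : m - b = - (n%:R^-1 *: v).
    rewrite /v add0r sumrB sumr_const card_ord -(scaler_nat n m) scalerBr scalerA.
    by rewrite mulVf ?gt_eqF// scale1r opprB.
  by rewrite bilNl bilNr opprK bilZl bilZr bilZA mulrA expr2.
have amin : forall t, 0 <= t <= 1 ->
    bil (gram ps) lh lh - 2 * bil 1%:M b lh <=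
    bil (gram ps) (lh + t *: a) (lh + t *: a) - 2 * bil 1%:M b (lh + t *: a).
  move=> t t01; have [lam'' sl'' <-] := subsimplex_segment t01 slh sl.
  by have := lhmin _ sl''; rewrite !aggregation_criterionE// lee_fin.
have := bil_argmin_le m Gs amin.
have -> : lh + a = trow lam by rewrite addrC subrK.
have := bil_reg_gram_le Gs Gpsd e'0 (m - b) a.
have := subsimplex_diff_le slh sl; rewrite -/lh -/a -/S => aM.
have : e' * bil 1%:M a a <= e by apply: le_trans e'M; rewrite ler_wpM2l ?(ltW e'0).
rewrite /r; lra.
Qed.

Lemma max_excess_risk_convex_aggregate_le (n : nat)
    (T : n.-tuple (Rd R d) -> Rd R d -> R) :
  (0 < n)%N -> convex_aggregate R d M ps n T ->
  (max_excess_risk (bounded_densities R d L) (subsimplex R M) ps T <=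
   (L * M%:R / n%:R)%:E)%E.
Proof.
move=> n0 aggT; apply: ge_ereal_sup => _ [p pP <-].
have pM j : has_integral mu (fun y => p y * ps j y)
    ((\row_j \int[mu]_y (p y * ps j y)) 0 j).
  by rewrite mxE; exact: (has_integral_density_mul psL2 L0 pP).
have lossE lam : (L2norm (mixture ps lam \- p)%R ^+ 2)%E \is a fin_num.
  by rewrite (sqr_L2norm_mixtureB psL2 lam pM (has_integral_density_sqr L0 pP)).
have oracle_ge0 : (0 <= oracle_risk (subsimplex R M) ps p)%E.
  apply: le_ereal_inf_tmp => _ [lam _ <-].
  by rewrite sqr_L2norm integral_ge0// => y _; rewrite lee_fin sqr_ge0.
(* The zero weights bound the oracle risk by the finite number [|p|^2], so it can be moved across
   the inequality. *)
have s0 : subsimplex R M [tuple 0 | j < M].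
  by split=> [j|]; rewrite ?tnth_mktuple// big1// => j _; rewrite tnth_mktuple.
have oracle_fin : oracle_risk (subsimplex R M) ps p \is a fin_num.
  rewrite ge0_fin_numE//.
  apply: (@le_lt_trans _ _ (L2norm (mixture ps [tuple 0 | j < M] \- p)%R ^+ 2)%E).
    by apply: ereal_inf_lbound; exists [tuple 0 | j < M].
  by rewrite ltey_eq lossE.
rewrite leeBlDr// -leeBlDl//; apply: le_ereal_inf_tmp => _ [lam sl <-].
by rewrite leeBlDl// addeC; exact: risk_le.
Qed.

End convex_aggregate_bound.

(** * Measurable selection of a minimizer *)

Section measurable_index.
Context d (X : measurableType d) (R : realType).

(** Stated through level sets, so that a construction depending on [N] splits into a countable
    union. *)
Definition measurable_index (N : X -> nat) :=
  forall i, measurable [set x | N x = i].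

Lemma measurable_fun_index (N : X -> nat) (h : nat -> X -> R) :
  measurable_index N -> (forall i, measurable_fun setT (h i)) ->
  measurable_fun setT (fun x => h (N x) x).
Proof.
move=> mN mh _ B mB; rewrite setTI.
rewrite (_ : _ @^-1` B = \bigcup_i ([set x | N x = i] `&` h i @^-1` B)).
  apply: bigcupT_measurable => i; apply: measurableI; first exact: mN.
  by rewrite -[X in measurable X]setTI; exact: mh.
by apply/seteqP; split => [x Bx|x [i _ [/= <-]]//]; exists (N x).
Qed.

Lemma measurable_index_comp (N : X -> nat) (s : nat -> X -> nat) :
  measurable_index N -> (forall i, measurable_index (s i)) ->
  measurable_index (fun x => s (N x) x).
Proof.
move=> mN ms j.
rewrite (_ : mkset _ =
    \bigcup_i ([set x | N x = i] `&` [set x | s i x = j])).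
  by apply: bigcupT_measurable => i; apply: measurableI; [exact: mN|exact: ms].
by apply/seteqP; split => [x /= <-|x [i _ [/= <-]]//]; exists (N x).
Qed.

(** Take the least index: [N x = i] means that [P i] holds at [x] and no earlier [P j] does. *)
Lemma measurable_first_index (P : nat -> set X) :
  (forall i, measurable (P i)) -> (forall x, exists i, P i x) ->
  exists2 N, measurable_index N & forall x, P (N x) x.
Proof.
move=> mP exP.
have exP' x : exists i, `[< P i x >].
  by have [i Pi] := exP x; exists i; exact/asboolP.
exists (fun x => ex_minn (exP' x)); last first.
  by move=> x; case: ex_minnP => i /asboolP.
move=> i; rewrite (_ : mkset _ =
    P i `&` \bigcap_(j in [set j | (j < i)%N]) ~` P j).
  apply: measurableI => //; apply: bigcap_measurableType => j _.
  exact: measurableC.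
apply/seteqP; split => x /=.
  case: ex_minnP => k /asboolP Pk kmin <-; split => // j /= jk Pj.
  have : (k <= j)%N by apply: kmin; exact/asboolP.
  by rewrite leqNgt jk.
move=> [Pi Pj]; case: ex_minnP => k /asboolP Pk kmin.
have ki : (k <= i)%N by apply: kmin; exact/asboolP.
apply/eqP; rewrite eqn_leq ki leqNgt; apply/negP => /Pj; exact.
Qed.

(** Some tail beyond [k] has its supremum within [e / 2] of the limit superior, and some term of
    that tail is within [e / 2] of the supremum. *)
Lemma limn_sup_cluster (u : nat -> R) (k : nat) (e : R) : 0 < e ->
  has_ubound (range u) -> has_lbound (range u) ->
  exists2 m, (k <= m)%N & `|u m - limn_sup u| < e.
Proof.
move=> e0 ub lb; have supsl := cvg_sups_inf ub lb.
rewrite (_ : limn_sup u = inf (range (sups u))); last exact/cvg_lim.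
set l := inf _ in supsl *.
have e20 : 0 < e / 2 by rewrite divr_gt0.
have /cvgrPdist_lt/(_ _ e20)[N _ HN] := supsl.
pose n := maxn N k.
have /= Hn := HN n (leq_maxl _ _).
have supn : has_sup (sdrop u n).
  split; first by exists (u n), n => /=.
  by have [M HM] := ub; exists M => _ [m _ <-]; apply: HM; exists m.
have [_ [m /= nm <-]] := sup_adherent e20 supn.
rewrite -[sup _]/(sups u n) => um.
exists m; first exact: leq_trans (leq_maxr _ _) nm.
have : u m <= sups u n by apply: ub_le_sup => //; [case: supn|exists m].
move: um Hn; rewrite !ltr_norml => um /andP[? ?] ?.
by apply/andP; split; lra.
Qed.

(** Bolzano-Weierstrass with a measurable choice: [tau k x] is the first index from [k] on at which
    [w] is within [1 / (k + 1)] of its limit superior, a measurable function. The bound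
    [k <= tau k x] replaces monotonicity and suffices for limits. *)
Lemma measurable_cvg_subsequence (w : nat -> X -> R) (C : R) :
  (forall k, measurable_fun setT (w k)) -> (forall k x, `|w k x| <= C) ->
  exists tau : nat -> X -> nat,
    [/\ forall k, measurable_index (tau k), forall k x, (k <= tau k x)%N &
      forall x, cvgn (fun k => w (tau k x) x)].
Proof.
move=> mw wC.
have ub x : has_ubound (range (w ^~ x)).
  by exists C => _ [k _ <-]; exact: le_trans (ler_norm _) (wC k x).
have lb x : has_lbound (range (w ^~ x)).
  by exists (- C) => _ [k _ <-]; have := wC k x; rewrite ler_norml => /andP[].
pose l x := limn_sup (w ^~ x).
have ml : measurable_fun setT l by apply: measurable_fun_limn_sup.
have exN k : exists2 N, measurable_index N &
    forall x, (k <= N x)%N /\ `|w (N x) x - l x| < k.+1%:R^-1.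
  apply: (@measurable_first_index
      (fun i => [set x | (k <= i)%N /\ `|w i x - l x| < k.+1%:R^-1])) => [i|x].
    have [ki|ki] := boolP (k <= i)%N; last first.
      by rewrite (_ : mkset _ = set0)//; apply/seteqP; split=> // x [].
    rewrite (_ : mkset _ = [set: X] `&`
        (fun x => `|w i x - l x| < k.+1%:R^-1) @^-1` [set true]); last first.
      by apply/seteqP; split=> [x [_ ?]|x [_ ?]].
    have := measurable_fun_ltr (D := setT) (f := fun x => `|w i x - l x|)
      (g := cst k.+1%:R^-1).
    move=> H; apply: H => //.
    by apply: measurableT_comp => //; exact: measurable_funB.
  have k0 : 0 < k.+1%:R^-1 :> R by rewrite invr_gt0.
  by have [m km Hm] := limn_sup_cluster k k0 (ub x) (lb x); exists m.
pose tau k := sval (cid2 (exN k)).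
have tauP k : measurable_index (tau k) /\
    forall x, (k <= tau k x)%N /\ `|w (tau k x) x - l x| < k.+1%:R^-1.
  by rewrite /tau; case: cid2.
exists tau; split=> [k|k x|x]; first by case: (tauP k).
  by have [_ /(_ x)[]] := tauP k.
apply/cvg_ex; exists (l x).
apply/cvgrPdist_lt => e e0.
near=> k; rewrite distrC; have [_ /(_ x)[_ /lt_trans]] := tauP k; apply.
near: k; exact: near_infty_natSinv_lt (PosNum e0).
Unshelve. all: by end_near. Qed.

Lemma cvgn_comp_index (u : nat -> R) (s : nat -> nat) (l : R) :
  (forall k, (k <= s k)%N) -> u @ \oo --> l -> (u \o s) @ \oo --> l.
Proof.
move=> ks ul; apply: cvg_comp ul => A [N _ NA].
by exists N => // k /= Nk; apply: NA; exact: leq_trans Nk (ks k).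
Qed.

(** Coordinates are treated one at a time, each extraction refining the previous one; coordinates
    that already converge still do, as the new indices tend to infinity. *)
Lemma measurable_cvg_subsequence_fin (M : nat) (w : 'I_M -> nat -> X -> R)
    (C : R) :
  (forall j k, measurable_fun setT (w j k)) ->
  (forall j k x, `|w j k x| <= C) ->
  exists tau : nat -> X -> nat,
    [/\ forall k, measurable_index (tau k), forall k x, (k <= tau k x)%N &
      forall j x, cvgn (fun k => w j (tau k x) x)].
Proof.
move=> mw wC.
suff H n : (n <= M)%N -> exists tau : nat -> X -> nat,
    [/\ forall k, measurable_index (tau k), forall k x, (k <= tau k x)%N &
      forall (j : 'I_M) x, (j < n)%N -> cvgn (fun k => w j (tau k x) x)].
  have [tau [? ? H3]] := H M (leqnn M).
  by exists tau; split=> // j x; exact: H3.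
elim: n => [_|n IHn nM].
  exists (fun k _ => k); split=> // k i.
  have [ki|ki] := eqVneq k i.
    by rewrite (_ : mkset _ = setT)//; apply/seteqP; split.
  by rewrite (_ : mkset _ = set0)//; apply/seteqP; split=> // x /eqP; rewrite (negbTE ki).
have [s [ms sk scvg]] := IHn (ltnW nM).
pose j0 := Ordinal nM.
have [t [mt tk tcvg]] := measurable_cvg_subsequence (C := C)
  (fun k => measurable_fun_index (ms k) (mw j0)) (fun k x => wC j0 (s k x) x).
exists (fun k x => s (t k x) x); split.
- by move=> k; exact: measurable_index_comp.
- by move=> k x; exact: leq_trans (tk k x) (sk _ x).
- move=> j x; rewrite ltnS leq_eqVlt => /predU1P[jn|jn].
    by rewrite (_ : j = j0); [exact: tcvg|exact/val_inj].
  have /cvg_ex[l wl] := scvg j x jn; apply/cvg_ex; exists l.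
  exact: (cvgn_comp_index (fun k => tk k x) wl).
Qed.

End measurable_index.

Lemma cvgn_sum (R : realType) (I : Type) (s : seq I) (f : I -> nat -> R)
    (l : I -> R) : (forall i, f i @ \oo --> l i) ->
  (fun k => \sum_(i <- s) f i k) @ \oo --> \sum_(i <- s) l i.
Proof.
move=> fl; elim: s => [|i s IHs].
  by rewrite big_nil; under eq_cvg do rewrite big_nil; exact: cvg_cst.
by rewrite big_cons; under eq_cvg do rewrite big_cons; exact: cvgD.
Qed.

Lemma subsimplex_dense (R : realType) (M : nat) :
  exists q : nat -> M.-tuple R, (forall i, subsimplex R M (q i)) /\
    forall lam, subsimplex R M lam -> exists s : nat -> nat,
      forall j, (fun k => tnth (q (s k)) j) @ \oo --> tnth lam j.
Proof.
(* Fractions with denominator [z.1 + 1]; the zero default keeps every grid point in the simplex.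
   Rounding down a point of the simplex stays inside and errs by less than [1 / (z.1 + 1)] per
   coordinate. *)
pose grid (z : nat * M.-tuple nat) : M.-tuple R :=
  if (\sum_(j < M) tnth z.2 j <= z.1.+1)%N
  then [tuple (tnth z.2 j)%:R / z.1.+1%:R | j < M] else [tuple 0 | j < M].
have grid_simplex z : subsimplex R M (grid z).
  rewrite /grid; case: ifPn => [zle|_]; split.
  - by move=> j; rewrite tnth_mktuple divr_ge0.
  - under eq_bigr do rewrite tnth_mktuple.
    by rewrite -mulr_suml -natr_sum ler_pdivrMr// mul1r ler_nat.
  - by move=> j; rewrite tnth_mktuple.
  - by rewrite big1// => j _; rewrite tnth_mktuple.
exists (fun i => grid (odflt (0, [tuple 0 | j < M]) (unpickle i))%N).
split=> // lam [l0 l1].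
pose z k := (k, [tuple Num.truncn (k.+1%:R * tnth lam j) | j < M]).
exists (fun k => pickle (z k)) => j.
have trunc_le k i : (Num.truncn (k.+1%:R * tnth lam i))%:R <= k.+1%:R * tnth lam i.
  by rewrite truncn_le mulr_ge0.
have zE k : tnth (grid (odflt (0, [tuple 0 | j < M]) (unpickle (pickle (z k))))%N) j =
    (Num.truncn (k.+1%:R * tnth lam j))%:R / k.+1%:R.
  rewrite pickleK /= /grid /= ifT ?tnth_mktuple//.
  rewrite -(ler_nat R) natr_sum.
  under eq_bigr do rewrite tnth_mktuple.
  apply: le_trans (ler_sum _ (fun i _ => trunc_le k i)) _.
  by rewrite -mulr_sumr ler_piMr.
apply/cvgrPdist_lt => e e0; near=> k.
have k0 : 0 < k.+1%:R :> R by [].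
rewrite zE; apply: (@le_lt_trans _ _ k.+1%:R^-1); last first.
  by near: k; exact: near_infty_natSinv_lt (PosNum e0).
have := trunc_le k j; have := truncnS_gt (k.+1%:R * tnth lam j).
set t := Num.truncn _; rewrite -[t.+1%:R]natr1 => t1 t2.
have -> : tnth lam j - t%:R / k.+1%:R = (k.+1%:R * tnth lam j - t%:R) / k.+1%:R.
  by rewrite mulrBl mulrAC mulfV ?mul1r// gt_eqF.
rewrite ger0_norm; last by apply: divr_ge0 => //; lra.
by rewrite -[leRHS]mul1r ler_pM2r ?invr_gt0//; lra.
Unshelve. all: by end_near. Qed.

Section measurable_argmin.
Context d (X : measurableType d) (R : realType) (M : nat).

Lemma measurable_argmin (F : X -> M.-tuple R -> R) :
  (forall lam, measurable_fun setT (F^~ lam)) ->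
  (forall x (u : nat -> M.-tuple R) lam,
    (forall j, (fun k => tnth (u k) j) @ \oo --> tnth lam j) ->
    (fun k => F x (u k)) @ \oo --> F x lam) ->
  exists lamhat : X -> M.-tuple R,
    (forall j, measurable_fun setT (fun x => tnth (lamhat x) j)) /\
    forall x, subsimplex R M (lamhat x) /\
      forall lam, subsimplex R M lam -> F x (lamhat x) <= F x lam.
Proof.
move=> mF cF; have [q [qs qd]] := subsimplex_dense R M.
(* A measurable choice of a best point among the first [n + 1] points of the dense sequence. *)
have exr n : exists2 N, measurable_index N &
    forall x i, (i <= n)%N -> F x (q (N x)) <= F x (q i).
  apply: (@measurable_first_index _ X
    (fun m => [set x | forall i, (i <= n)%N -> F x (q m) <= F x (q i)])).
    move=> m; rewrite (_ : mkset _ = \bigcap_(i in [set i | (i <= n)%N])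
        [set x | F x (q m) <= F x (q i)]); last by apply/seteqP; split.
    apply: bigcap_measurableType => i _; rewrite -[X in measurable X]setTI.
    have H := measurable_fun_ler (mF (q m)) (mF (q i)).
    by have := H measurableT [set true]; rewrite setTI; apply.
  move=> x; have [i _ imin] := @arg_minP _ R _ (ord0 : 'I_n.+1) xpredT
    (fun i => F x (q i)) isT.
  by exists i => k kn; exact: (imin (Ordinal (kn : (k < n.+1)%N)) isT).
pose r n := s2val (cid2 (exr n)).
have mr n : measurable_index (r n) := s2valP (cid2 (exr n)).
have rmin n x i : (i <= n)%N -> F x (q (r n x)) <= F x (q i) :=
  @s2valP' _ _ _ (cid2 (exr n)) x i.
have mqr j k : measurable_fun setT (fun x => tnth (q (r k x)) j).
  exact: (measurable_fun_index (h := fun i _ => tnth (q i) j) (mr k)).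
have qr1 j k x : `|tnth (q (r k x)) j| <= 1.
  by have /andP[? ?] := subsimplex_le1 j (qs (r k x)); rewrite ger0_norm.
have [tau [mtau taule taucvg]] := measurable_cvg_subsequence_fin mqr qr1.
pose lamhat x := [tuple limn (fun k => tnth (q (r (tau k x) x)) j) | j < M].
have lamcvg x j :
    (fun k => tnth (q (r (tau k x) x)) j) @ \oo --> tnth (lamhat x) j.
  by rewrite tnth_mktuple; exact: taucvg.
exists lamhat; split=> [j|x].
  apply: (measurable_fun_cvg (h := fun k x => tnth (q (r (tau k x) x)) j)) => //.
  move=> k; exact: (measurable_fun_index
    (h := fun i x => tnth (q (r i x)) j) (mtau k)).
split.
  split=> [j|].
    rewrite tnth_mktuple; apply: limr_ge; first exact: taucvg.
    by apply: nearW => k; have [] := qs (r (tau k x) x).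
  have sumcvg := cvgn_sum (s := index_enum 'I_M) (lamcvg x).
  rewrite -(cvg_lim _ sumcvg)//.
  apply: limr_le; first by apply/cvg_ex; eexists; exact: sumcvg.
  by apply: nearW => k; have [] := qs (r (tau k x) x).
move=> lam slam.
(* From [k = i] on, [tau k x >= i], so [q i] is among the points already beaten; continuity passes
   this to the limit. *)
have qle i : F x (lamhat x) <= F x (q i).
  have Fcvg := cF x _ _ (lamcvg x).
  rewrite -(cvg_lim _ Fcvg)//; apply: limr_le; first by apply/cvg_ex; eexists; exact: Fcvg.
  exists i => // k /= ik; apply: rmin.
  exact: leq_trans ik (taule k x).
have [s slamcvg] := qd _ slam.
have Fcvg := cF x _ _ slamcvg.
rewrite -[leRHS](cvg_lim _ Fcvg)//; apply: limr_ge; first by apply/cvg_ex; eexists; exact: Fcvg.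
by apply: nearW.
Qed.

End measurable_argmin.

Lemma exists_convex_aggregate (R : realType) (d M : nat)
    (ps : 'I_M -> Rd R d -> R) (n : nat) : in_L2 ps ->
  exists T : n.-tuple (Rd R d) -> Rd R d -> R, convex_aggregate R d M ps n T.
Proof.
move=> psL2; have mps := measurable_in_L2 psL2.
pose F (x : n.-tuple (Rd R d)) (lam : M.-tuple R) :=
  bil (gram ps) (trow lam) (trow lam) -
  2 * bil 1%:M (sample_mean ps x) (trow lam).
have mmean j : measurable_fun setT
    (fun x : n.-tuple (Rd R d) => sample_mean ps x 0 j).
  under eq_fun do rewrite mxE summxE.
  apply: measurable_funM => //; apply: measurable_sum => k.
  under eq_fun do rewrite mxE.
  exact: measurableT_comp (mps j) (measurable_tnth k).
have [|x u lam ulam|lamhat [mlam lamP]] := @measurable_argmin _ _ R M F.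
- move=> lam; apply: measurable_funB => //; apply: measurable_funM => //.
  under eq_fun do rewrite bil1E.
  by apply: measurable_sum => j; apply: measurable_funM.
- have utrow j : (fun k => trow (u k) 0 j) @ \oo --> trow lam 0 j.
    by rewrite mxE; under eq_cvg do rewrite mxE; exact: ulam.
  apply: cvgB.
    rewrite bilE; under eq_cvg do rewrite bilE.
    apply: cvgn_sum => i; apply: cvgn_sum => j.
    by apply: cvgM; [exact: cvg_cst|exact: cvgM].
  apply: cvgM; first exact: cvg_cst.
  rewrite bil1E; under eq_cvg do rewrite bil1E.
  by apply: cvgn_sum => j; apply: cvgM; [exact: cvg_cst|].
- exists (fun x => mixture ps (lamhat x)); split.
    apply: measurable_sum => j; apply: measurable_funM.
      exact: measurableT_comp (mlam j) measurable_fst.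
    exact: measurableT_comp (mps j) measurable_snd.
  exists lamhat => x; have [? lammin] := lamP x; split=> // lam slam.
  by rewrite !aggregation_criterionE// lee_fin; exact: lammin.
Qed.

(** * Step functions on disjoint cells *)

Section step.
Context dT (T : measurableType dT) (R : realType).
Variables (mu : {measure set T -> \bar R}) (I : finType) (B : I -> set T) (v : R).
Hypotheses (mB : forall i, measurable (B i)) (muB : forall i, mu (B i) = v%:E).
Hypothesis dB : forall i j y, B i y -> B j y -> i = j.

Definition step (u : I -> R) (y : T) : R := \sum_i u i * \1_(B i) y.

Lemma step_in u i y : B i y -> step u y = u i.
Proof.
move=> Biy; rewrite /step (bigD1 i)//= indicE mem_set// mulr1 big1 ?addr0//.
move=> j ji; rewrite indicE memNset ?mulr0// => Bjy.
by rewrite (dB Bjy Biy) eqxx in ji.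
Qed.

Lemma step_out u y : (forall i, ~ B i y) -> step u y = 0.
Proof.
by move=> NB; rewrite /step big1// => i _; rewrite indicE memNset ?mulr0//; exact: NB.
Qed.

(* Abstracting over the evaluation at [y] allows a relation between several step
   functions to be checked cell by cell. *)
Lemma step_cases (P : ((I -> R) -> R) -> Prop) y :
  (forall i, P (fun u => u i)) -> P (fun=> 0) -> P (step^~ y).
Proof.
move=> Pin Pout; have [[i Biy]|NB] := pselect (exists i, B i y).
  rewrite (_ : step^~ y = fun u => u i)//; apply/funext => u; exact: step_in.
rewrite (_ : step^~ y = fun=> 0)//; apply/funext => u; apply: step_out => i Biy.
by apply: NB; exists i.
Qed.

Lemma measurable_step u : measurable_fun setT (step u).
Proof.
by apply: measurable_sum => i; apply: measurable_funM => //; exact: measurable_indic.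
Qed.

Lemma step_ge0 u y : (forall i, 0 <= u i) -> 0 <= step u y.
Proof. by move=> u0; rewrite sumr_ge0// => i _; rewrite mulr_ge0// indicE. Qed.

Lemma integral_step u : (forall i, 0 <= u i) ->
  (\int[mu]_y (step u y)%:E = (\sum_i u i * v)%:E)%E.
Proof.
move=> u0; under eq_integral do rewrite -sumEFin.
rewrite ge0_integral_sum//=; last 2 first.
- move=> i; apply/measurable_EFinP.
  by apply: measurable_funM => //; exact: measurable_indic.
- by move=> i y _; rewrite lee_fin mulr_ge0// indicE.
rewrite -sumEFin; apply: eq_bigr => i _.
under eq_integral do rewrite EFinM.
rewrite ge0_integralZl//=; last 2 first.
- by apply/measurable_EFinP; exact: measurable_indic.
- by rewrite lee_fin.
by rewrite integral_indic// setIT muB EFinM.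
Qed.

Lemma step_Lfun2 u : step u \in Lfun mu 2%:E.
Proof.
apply: measurable_sqr_Lfun2; first exact: measurable_step.
rewrite (_ : (\int[mu]_x _ = \int[mu]_x (step (fun i => u i ^+ 2) x)%:E)%E).
  by rewrite integral_step ?ltry// => i; exact: sqr_ge0.
apply: eq_integral => y _; congr EFin.
by apply: (step_cases (P := fun e => e u ^+ 2 = e (fun i => u i ^+ 2))) => //;
  rewrite expr0n.
Qed.

End step.

(** Adjacent half-open intervals of length [v] on the first axis, which exists as [d >= 1], times
    the unit interval on every other axis. *)
Lemma exists_disjoint_cells (R : realType) (d : nat) (I : finType) (v : R) :
  (1 <= d)%N -> 0 < v ->
  exists B : I -> set (Rd R d), [/\ forall i, measurable (B i),
    forall i, leb R d (B i) = v%:E & forall i j y, B i y -> B j y -> i = j].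
Proof.
case: d => // d _ v0.
pose A (k : nat) (i : 'I_d.+1) : set R :=
  if i == ord0 then `[k%:R * v, k%:R * v + v[%classic else `[0, 1[%classic.
have mA k i : measurable (A k i : set (measurableTypeR R)).
  by rewrite /A; case: ifP.
pose box k : set (Rd R d.+1) := [set y | forall i, A k i (tnth y i)].
exists (fun i => box (enum_rank i)); split=> [i|i|i j y].
- rewrite (_ : box _ = \bigcap_(k in [set: 'I_d.+1])
    (tnth (T := R))^~ k @^-1` A (enum_rank i) k).
    apply: fin_bigcap_measurable => // k _.
    by rewrite -[X in measurable X]setTI; exact: measurable_tnth.
  apply/seteqP; split => [t At k _|t At k]; first exact: At.
  exact: (At k Logic.I).
- rewrite /leb tuple_measure_box// big_ord_recl big1.
    rewrite mule1 /A eqxx; apply: etrans (lebesgue_measure_itv _) _.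
    rewrite /= lte_fin ltrDl v0.
    by rewrite -EFinB addrAC subrr add0r.
  move=> k _; rewrite /A /=; apply: etrans (lebesgue_measure_itv _) _.
  rewrite /= lte_fin ltr01.
  by rewrite sube0.
- move=> /(_ ord0) + /(_ ord0); rewrite /A eqxx /= !in_itv/=.
  move=> /andP[h1 h2] /andP[h3 h4]; apply/enum_rank_inj/val_inj/eqP => /=.
  have cell_le (a b : nat) (t : R) : a%:R * v <= t -> t < b%:R * v + v -> (a <= b)%N.
    move=> /le_lt_trans h /h {h}.
    by rewrite -[X in _ + X]mul1r -mulrDl natr1 ltr_pM2r// ltr_nat ltnS.
  by rewrite eqn_leq (cell_le _ _ _ h1 h4) (cell_le _ _ _ h3 h2).
Qed.

(** * Elementary inequalities for the two-point comparison *)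

Lemma exp1D_le2 (R : realFieldType) (n : nat) (z : R) :
  0 <= z -> n%:R * z <= 2^-1 -> (1 + z) ^+ n <= 2.
Proof.
move=> z0 nz.
(* The second factor is at least 1/2. *)
suff H : (1 + z) ^+ n * (1 - n%:R * z) <= 1.
  have z1 : 0 <= (1 + z) ^+ n by rewrite exprn_ge0// addr_ge0.
  by nra.
elim: n {nz} => [|n IH]; first by rewrite mul0r subr0 mulr1.
apply: le_trans IH; rewrite exprSr -mulrA ler_wpM2l ?exprn_ge0 ?addr_ge0//.
rewrite -natr1; have : 0 <= n%:R * z ^+ 2 by rewrite mulr_ge0 ?sqr_ge0.
by have := sqr_ge0 z; nra.
Qed.

(* With [r = q / p] this is [r / (1 + r) >= (3 r - r^2) / 4], since the infimum
   of [p a^2 + q b^2] under [|a - b| = s] is [s^2 p q / (p + q)]. *)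
Lemma two_point_le (R : realFieldType) (p q a b : R) : 0 < p -> 0 <= q ->
  3 / 4 * (a - b) ^+ 2 * q <=
  p * a ^+ 2 + q * b ^+ 2 + (a - b) ^+ 2 / 4 * (q ^+ 2 / p).
Proof.
move=> p0 q0; rewrite -subr_ge0.
have pq0 : 0 < p + q by lra.
rewrite [leRHS](_ : _ = (p * a + q * b) ^+ 2 / (p + q) +
   (a - b) ^+ 2 * (q * (p - q) ^+ 2 / (4 * p * (p + q)))).
  apply: addr_ge0; first by rewrite divr_ge0 ?sqr_ge0// ltW.
  apply: mulr_ge0; first exact: sqr_ge0.
  apply: divr_ge0; first by rewrite mulr_ge0// sqr_ge0.
  by rewrite ltW// !mulr_gt0.
by field; rewrite !gt_eqF.
Qed.

(** * Assouad's lemma *)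

(** Extension to [p = 0]: there [q = 0] as well, and both sides vanish because division by zero
    gives zero. *)
Lemma two_point_le0 (R : realFieldType) (p q a b : R) : 0 <= p -> 0 <= q ->
  (p = 0 -> q = 0) ->
  3 / 4 * (a - b) ^+ 2 * q <=
  p * a ^+ 2 + q * b ^+ 2 + (a - b) ^+ 2 / 4 * (q ^+ 2 / p).
Proof.
move=> p0 q0 pq; have [p1|p1|/esym p1] := ltgtP 0 p; last 2 first.
- by move: p0; rewrite leNgt p1.
- by rewrite (pq p1) p1 !mul0r expr0n/= mul0r !mulr0 !addr0.
- exact: two_point_le.
Qed.

Definition bit_sign (R : realType) (b : bool) : R := if b then 1 else -1.

Lemma bit_factor_itv (R : realType) (b b' : bool) (e : R) :
  0 <= e -> e <= 2^-1 -> 0 < 1 + b%:R * (e * bit_sign R b') <= 2.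
Proof. by case: b; case: b'; rewrite /bit_sign /=; lra. Qed.

Definition flip_bit (m : nat) (j : 'I_m) (w : {ffun 'I_m -> bool}) :
    {ffun 'I_m -> bool} := [ffun i => if i == j then ~~ w i else w i].

Lemma flip_bitK (m : nat) (j : 'I_m) : involutive (flip_bit j).
Proof.
by move=> w; apply/ffunP => i; rewrite !ffunE; case: eqP => // _; rewrite negbK.
Qed.

(** Average over all [w]. Flipping bit [j] permutes the cube, so the average of [r w j] is at least
    [delta / 2] for each of the [m] bits. *)
Lemma assouad_sum (R : realFieldType) (m : nat)
    (r : {ffun 'I_m -> bool} -> 'I_m -> R) (delta s : R) :
  (forall w j, delta <= r w j + r (flip_bit j w) j) ->
  (forall w, \sum_j r w j <= s) -> m%:R * delta / 2 <= s.
Proof.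
move=> rdelta rs.
have N0 : 0 < #|{ffun 'I_m -> bool}|%:R :> R.
  by rewrite ltr0n; apply/card_gt0P; exists [ffun=> true].
have le1 : \sum_w \sum_j r w j <= #|{ffun 'I_m -> bool}|%:R * s.
  by rewrite mulr_natl -sumr_const; apply: ler_sum.
have le2 : #|{ffun 'I_m -> bool}|%:R * (m%:R * delta) <= 2 * \sum_w \sum_j r w j.
  rewrite exchange_big/= mulr_sumr !mulr_natl -mulrnA mulnC mulrnA.
  rewrite -[X in _ *+ X]card_ord -sumr_const; apply: ler_sum => j _.
  rewrite mulr_natl mulr2n.
  rewrite [X in _ <= X + _](reindex_inj (inv_inj (flip_bitK j)))/= -big_split/=.
  by rewrite -sumr_const; apply: ler_sum => w _; rewrite addrC.
rewrite ler_pdivrMr// -(ler_pM2l N0); apply: le_trans le2 _.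
by rewrite mulrA mulrC ler_wpM2r.
Qed.

(** The chi-square correction [E / 4] takes at most 2/4 out of 3/4, which leaves 1/4. *)
Lemma quarter_add_le (R : realFieldType) (D v E : R) : 0 <= D * v -> E <= 2 ->
  D / 4 * (2 * v) + D / 4 * (2 * v) * E <= 3 / 4 * D * (2 * v).
Proof.
move=> D0 E2; have : D * v * E <= D * v * 2 by rewrite ler_wpM2l.
by move: D0; rewrite -[D / 4 * _ * E](_ : D * v * E / 2 = _); [lra|field].
Qed.

Section assouad.
Context (R : realType) (d m : nat) (L e : R).
Hypotheses (L0 : 0 < L) (m0 : (0 < m)%N) (e0 : 0 <= e) (e1 : e <= 2^-1).
Variable B : 'I_m * bool -> set (Rd R d).
Let v := (L * m%:R)^-1.
Hypotheses (mB : forall i, measurable (B i)) (muB : forall i, leb R d (B i) = v%:E).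
Hypothesis dB : forall i j y, B i y -> B j y -> i = j.
Local Notation mu := (leb R d).
Implicit Types (w : {ffun 'I_m -> bool}) (j : 'I_m).

(** The [2 m] cells of volume [1 / (L m)] give the constant height [L / 2] total mass one, and
    perturbing it by a factor at most 2 respects the bound [L]. *)
Let h := L / 2.
Let h0 : 0 < h. Proof. by rewrite divr_gt0. Qed.
Let mR : 0 < m%:R :> R. Proof. by rewrite ltr0n. Qed.
Let v0 : 0 < v. Proof. by rewrite invr_gt0 mulr_gt0. Qed.

Definition bit_coef w (k : 'I_m * bool) : R :=
  h * (1 + (w k.1)%:R * (e * bit_sign R k.2)).

Definition bit_density w : Rd R d -> R := step B (bit_coef w).

(** The indicator of the two cells governed by bit [j], used to localize the loss. *)
Definition bit_cell j : Rd R d -> R := step B (fun k => (k.1 == j)%:R).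

Lemma bit_coef_gt0 w k : 0 < bit_coef w k.
Proof.
by rewrite mulr_gt0//; have /andP[] := bit_factor_itv (w k.1) k.2 e0 e1.
Qed.

Lemma bit_coef_le w k : bit_coef w k <= L.
Proof.
have -> : L = h * 2 by rewrite divfK.
by rewrite ler_wpM2l ?(ltW h0)//; have /andP[] := bit_factor_itv (w k.1) k.2 e0 e1.
Qed.

Lemma bit_density_ge0 w y : 0 <= bit_density w y.
Proof. by apply: step_ge0 => k; exact/ltW/bit_coef_gt0. Qed.

Lemma measurable_bit_density w : measurable_fun setT (bit_density w).
Proof. exact: measurable_step. Qed.

Lemma sum_cells (f : 'I_m * bool -> R) :
  \sum_k f k * v = \sum_i (f (i, true) + f (i, false)) * v.
Proof.
transitivity (\sum_(k : 'I_m * bool) f (k.1, k.2) * v).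
  by apply: eq_bigr => -[].
rewrite -(pair_bigA _ (fun i b => f (i, b) * v))/=.
by apply: eq_bigr => i _; rewrite big_bool mulrDl.
Qed.

Let hv : h * v = (2 * m%:R)^-1.
Proof. by rewrite /h /v; field; rewrite !gt_eqF. Qed.

Lemma sum_const_cells : \sum_(i < m) (m%:R : R)^-1 = 1.
Proof. by rewrite sumr_const card_ord -[LHS]mulr_natl mulfV// gt_eqF. Qed.

Lemma bit_density_bounded w : bounded_densities R d L (bit_density w).
Proof.
have cge0 k : 0 <= bit_coef w k by exact/ltW/bit_coef_gt0.
split; first split.
- exact: measurable_bit_density.
- exact: bit_density_ge0.
- rewrite (integral_step mB muB)// sum_cells -[RHS]/(1%:E) -sum_const_cells.
  congr EFin; apply: eq_bigr => i _; rewrite /bit_coef /bit_sign/= -mulrDr mulrAC hv.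
  by field; rewrite gt_eqF.
- rewrite unlock; case: ifP => [_|]; last by rewrite lee_fin ltW.
  apply/ess_supP/aeW => y /=; rewrite lee_fin ger0_norm ?bit_density_ge0//.
  apply: (step_cases dB (P := fun f => f (bit_coef w) <= L)); last exact: ltW.
  exact: bit_coef_le.
Qed.

Lemma measurable_bit_cell j : measurable_fun setT (bit_cell j).
Proof. exact: measurable_step. Qed.

Lemma bit_cell_ge0 j y : 0 <= bit_cell j y.
Proof. by apply: step_ge0. Qed.

Lemma integral_bit_cell j : (\int[mu]_y (bit_cell j y)%:E = (2 * v)%:E)%E.
Proof.
rewrite (integral_step mB muB)// sum_cells (bigD1 j)//= eqxx big1 ?addr0//.
by move=> i /negbTE ij; rewrite ij addr0 mul0r.
Qed.

Lemma sum_bit_cell_le1 y : \sum_j bit_cell j y <= 1.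
Proof.
apply: (step_cases dB (P := fun f => \sum_j f (fun k => (k.1 == j)%:R) <= 1)).
  move=> k; rewrite (bigD1 k.1)//= eqxx big1 ?addr0// => i.
  by rewrite eq_sym => /negbTE ->.
by rewrite big1.
Qed.

(** * Localization of the risk to single bits *)

Section bit_risk.
Context (n : nat) (T : n.-tuple (Rd R d) -> Rd R d -> R).
Hypothesis mT : is_estimator T.

Definition bit_loss w j (x : n.-tuple (Rd R d)) : \bar R :=
  (\int[mu]_y ((T x y - bit_density w y) ^+ 2 * bit_cell j y)%:E)%E.

Definition bit_risk w j : \bar R := sample_expectation (bit_density w) (bit_loss w j).

Lemma bit_loss_ge0 w j x : (0 <= bit_loss w j x)%E.
Proof.
by apply: integral_ge0 => y _; rewrite lee_fin mulr_ge0 ?sqr_ge0// bit_cell_ge0.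
Qed.

Let measurable_bit_sqr w j : measurable_fun setT
  (fun z : n.-tuple (Rd R d) * Rd R d =>
     (T z.1 z.2 - bit_density w z.2) ^+ 2 * bit_cell j z.2).
Proof.
apply: measurable_funM.
  apply: measurable_funX; apply: measurable_funB => //.
  by apply: measurableT_comp => //; exact: measurable_bit_density.
by apply: measurableT_comp => //; exact: measurable_bit_cell.
Qed.

Lemma measurable_bit_loss w j : measurable_fun setT (bit_loss w j).
Proof.
apply: (@measurable_fun_fubini_tonelli_F _ _ _ _ _ (leb R d)
  (fun z : n.-tuple (Rd R d) * Rd R d =>
     ((T z.1 z.2 - bit_density w z.2) ^+ 2 * bit_cell j z.2)%:E)).
  by apply/measurable_EFinP; exact: measurable_bit_sqr.
by move=> z; rewrite lee_fin mulr_ge0 ?sqr_ge0// bit_cell_ge0.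
Qed.

Lemma measurable_bit_integrand w j x : measurable_fun setT
  (fun y => (T x y - bit_density w y) ^+ 2 * bit_cell j y).
Proof.
have := measurableT_comp (measurable_bit_sqr w j)
  (pair1_measurable (T2 := Rd R d) x).
exact.
Qed.

(** The cells of different bits are disjoint, so the localized losses add up to at most the full
    loss. *)
Lemma sum_bit_risk_le w :
  (\sum_(j < m) bit_risk w j <= risk T (bit_density w))%E.
Proof.
have mp := measurable_bit_density w.
have mP : measurable_fun setT (fun t : n.-tuple (Rd R d) =>
    (\prod_(i < n) bit_density w (tnth t i))%:E).
  by apply/measurable_EFinP; exact: measurable_prod_tnth.
have P0 (t : n.-tuple (Rd R d)) :
    (0 <= (\prod_(i < n) bit_density w (tnth t i))%:E)%E.
  by rewrite lee_fin prodr_ge0// => i _; exact: bit_density_ge0.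
rewrite /bit_risk /sample_expectation -ge0_integral_sum//; last 2 first.
- by move=> j; apply: emeasurable_funM => //; exact: measurable_bit_loss.
- by move=> j x _; rewrite mule_ge0// bit_loss_ge0.
rewrite (eq_integral (fun x => (\prod_(i < n) bit_density w (tnth x i))%:E *
    \sum_(j < m) bit_loss w j x)%E); last first.
  by move=> x _; rewrite ge0_sume_distrr// => j _; exact: bit_loss_ge0.
apply: (ge0_le_sample_expectation mp).
- exact: bit_density_ge0.
- by apply: emeasurable_sum => j; exact: measurable_bit_loss.
- by move=> x; apply: sume_ge0 => j _; exact: bit_loss_ge0.
- exact: measurable_risk_integrand.
move=> x; rewrite sqr_L2norm /bit_loss -ge0_integral_sum//; last 2 first.
- by move=> j; apply/measurable_EFinP; exact: measurable_bit_integrand.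
- by move=> j y _; rewrite lee_fin mulr_ge0 ?sqr_ge0// bit_cell_ge0.
apply: ge0_le_integral => //.
- by move=> y _; apply: sume_ge0 => j _; rewrite lee_fin mulr_ge0 ?sqr_ge0// bit_cell_ge0.
- by apply: emeasurable_sum => j; apply/measurable_EFinP; exact: measurable_bit_integrand.
- apply/measurable_EFinP; apply: measurable_funX; apply: measurable_funB => //.
  have := measurableT_comp mT (pair1_measurable (T2 := Rd R d) x); exact.
- move=> y _; rewrite sumEFin lee_fin -mulr_sumr.
  by rewrite ler_piMr ?sqr_ge0// sum_bit_cell_le1.
Qed.

End bit_risk.

(** * Comparison of two densities differing in one bit *)

Section pair.
Variables (w w' : {ffun 'I_m -> bool}) (j : 'I_m).
Hypotheses (wj : w j = false) (wj' : w' j = true).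
Hypothesis ww' : forall i, i != j -> w' i = w i.
Let p := bit_density w.
Let q := bit_density w'.
(** The ratio [q^2 / p], whose integral is one plus the chi-square divergence of [q] from [p]. *)
Let g := step B (fun k => bit_coef w' k ^+ 2 / bit_coef w k).

Lemma bit_ratioE y : g y = q y ^+ 2 / p y.
Proof.
apply: (step_cases dB (P := fun f => f (fun k => bit_coef w' k ^+ 2 / bit_coef w k)
  = f (bit_coef w') ^+ 2 / f (bit_coef w))) => //.
by rewrite expr0n mul0r.
Qed.

Lemma bit_density_eq0 y : p y = 0 -> q y = 0.
Proof.
apply: (step_cases dB (P := fun f => f (bit_coef w) = 0 -> f (bit_coef w') = 0)) => //.
by move=> k /eqP; rewrite gt_eqF// bit_coef_gt0.
Qed.

Lemma bit_ratio_ge0 y : 0 <= g y.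
Proof.
by apply: step_ge0 => k; rewrite divr_ge0 ?sqr_ge0// ltW// bit_coef_gt0.
Qed.

(** Only bit [j] contributes an excess: its two cells give [(1 + e)^2 + (1 - e)^2 = 2 + 2 e^2] with
    weight [h v = 1 / (2 m)]. *)
Lemma integral_bit_ratio :
  (\int[mu]_y (g y)%:E = (1 + e ^+ 2 / m%:R)%:E)%E.
Proof.
rewrite (integral_step mB muB); last first.
  by move=> k; rewrite divr_ge0 ?sqr_ge0// ltW// bit_coef_gt0.
rewrite sum_cells; congr EFin.
transitivity (\sum_(i < m) (m%:R : R)^-1 + e ^+ 2 / m%:R); last first.
  by rewrite sum_const_cells.
rewrite (bigD1 j)//= [in RHS](bigD1 j)//= addrAC; congr (_ + _).
  rewrite /bit_coef /bit_sign/= wj wj' /= !mul0r addr0 mulr1 !mul1r.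
  rewrite (_ : (_ + _) * v = (h * v) * (2 + 2 * e ^+ 2)).
    by rewrite hv; field; rewrite gt_eqF.
  by field; rewrite gt_eqF.
apply: eq_bigr => i ij; rewrite /bit_coef/= ww'//.
have c0 b := bit_coef_gt0 w (i, b).
rewrite !expr2 !mulfK; last 2 first.
- by have := c0 false; rewrite /bit_coef/= => /gt_eqF ->.
- by have := c0 true; rewrite /bit_coef/= => /gt_eqF ->.
by rewrite /bit_sign -mulrDr mulrAC hv; field; rewrite gt_eqF.
Qed.

Lemma bit_cell_pair y : bit_cell j y = 0 \/
  bit_cell j y = 1 /\ (p y - q y) ^+ 2 = (h * e) ^+ 2.
Proof.
apply: (step_cases dB (P := fun f => f (fun k => (k.1 == j)%:R) = 0 \/
  f (fun k => (k.1 == j)%:R) = 1 /\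
  (f (bit_coef w) - f (bit_coef w')) ^+ 2 = (h * e) ^+ 2)); last by left.
move=> [i b] /=; have [->|_] := eqVneq i j; last by left.
by right; split=> //; rewrite /bit_coef/= wj wj'/= /bit_sign; case: b; ring.
Qed.

Context (n : nat) (T : n.-tuple (Rd R d) -> Rd R d -> R).
Hypothesis mT : is_estimator T.

Local Notation likelihood f x := (\prod_(i < n) f (tnth x i)).

(** The two-point inequality weighted by the likelihoods [P] and [Q], with the two estimation errors
    as [a] and [b]; their difference is free of [T]. The likelihood of [g] is [Q^2 / P]. *)
Lemma bit_pair_pointwise (x : n.-tuple (Rd R d)) y :
  3 / 4 * (h * e) ^+ 2 * likelihood q x * bit_cell j y <=
  likelihood p x * ((T x y - p y) ^+ 2 * bit_cell j y) +
  likelihood q x * ((T x y - q y) ^+ 2 * bit_cell j y) +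
  (h * e) ^+ 2 / 4 * likelihood g x * bit_cell j y.
Proof.
set P := likelihood p x; set Q := likelihood q x; set G := likelihood g x.
have [->|[-> pq]] := bit_cell_pair y.
  by rewrite !mulr0 !addr0.
have GE : G = Q ^+ 2 / P.
  rewrite /G /Q /P -prodrXl -prodfV -big_split/=.
  by apply: eq_bigr => i _; exact: bit_ratioE.
rewrite !mulr1 GE.
have := @two_point_le0 R P Q (T x y - p y) (T x y - q y).
rewrite (_ : T x y - p y - (T x y - q y) = - (p y - q y)); last by ring.
rewrite sqrrN pq; apply.
- by apply: prodr_ge0 => i _; exact: bit_density_ge0.
- by apply: prodr_ge0 => i _; exact: bit_density_ge0.
(* [P] vanishes only when some observation falls outside all cells, and then [Q] vanishes too. *)
- move=> /eqP; rewrite prodf_seq_eq0 => /hasP[i _ /eqP /= pi0].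
  by apply/eqP; rewrite prodf_seq_eq0; apply/hasP; exists i => //;
    rewrite (bit_density_eq0 pi0) eqxx.
Qed.

(* [2 v (h e)^2] is the squared L2 distance between the two densities. *)
Lemma bit_risk_pair_ge :
  ((3 / 4 * (h * e) ^+ 2 * (2 * v))%:E <= bit_risk T w j + bit_risk T w' j +
   ((h * e) ^+ 2 / 4 * (2 * v) * (1 + e ^+ 2 / m%:R) ^+ n)%:E)%E.
Proof.
have he0 : 0 <= (h * e) ^+ 2 by exact: sqr_ge0.
have c0 : 0 <= 3 / 4 * (h * e) ^+ 2 by rewrite mulr_ge0.
have c0' : 0 <= (h * e) ^+ 2 / 4 by rewrite divr_ge0.
have v20 : 0 <= 2 * v by rewrite mulr_ge0// ltW.
have mp := measurable_bit_density w; have mq := measurable_bit_density w'.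
have p0 := bit_density_ge0 w; have q0 := bit_density_ge0 w'.
have mg : measurable_fun setT g by exact: measurable_step.
have mL (f : Rd R d -> R) : measurable_fun setT f ->
    measurable_fun setT (fun x : n.-tuple (Rd R d) => (likelihood f x)%:E).
  by move=> mf; apply/measurable_EFinP; exact: measurable_prod_tnth.
have L0' (f : Rd R d -> R) (x : n.-tuple (Rd R d)) : (forall y, 0 <= f y) ->
    (0 <= (likelihood f x)%:E)%E.
  by move=> f0; rewrite lee_fin prodr_ge0.
have q1 : (\int[mu]_y (q y)%:E = 1%:E)%E by have [[]] := bit_density_bounded w'.
have mcell : measurable_fun setT (fun y => (bit_cell j y)%:E).
  by apply/measurable_EFinP; exact: measurable_bit_cell.
have cell0 y : (0 <= (bit_cell j y)%:E)%E by rewrite lee_fin bit_cell_ge0.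
have mloss w0 x : measurable_fun setT
    (fun y => ((T x y - bit_density w0 y) ^+ 2 * bit_cell j y)%:E).
  by apply/measurable_EFinP; exact: measurable_bit_integrand.
have loss0 w0 x y : (0 <= ((T x y - bit_density w0 y) ^+ 2 * bit_cell j y)%:E)%E.
  by rewrite lee_fin mulr_ge0 ?sqr_ge0// bit_cell_ge0.
(* The pointwise inequality integrated over [y] for a fixed sample. *)
have key (x : n.-tuple (Rd R d)) :
    ((3 / 4 * (h * e) ^+ 2 * (2 * v))%:E * (likelihood q x)%:E <=
     (likelihood p x)%:E * bit_loss T w j x +
     (likelihood q x)%:E * bit_loss T w' j x +
     ((h * e) ^+ 2 / 4 * (2 * v))%:E * (likelihood g x)%:E)%E.
  have pL := L0' p x p0; have qL := L0' q x q0.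
  have gL : (0 <= (likelihood g x)%:E)%E := L0' g x bit_ratio_ge0.
  have := @ge0_le_integral _ _ R mu setT measurableT (fun y =>
      (3 / 4 * (h * e) ^+ 2 * likelihood q x)%:E * (bit_cell j y)%:E)%E
    (fun y => (likelihood p x)%:E *
        ((T x y - p y) ^+ 2 * bit_cell j y)%:E +
      (likelihood q x)%:E * ((T x y - q y) ^+ 2 * bit_cell j y)%:E +
      ((h * e) ^+ 2 / 4 * likelihood g x)%:E * (bit_cell j y)%:E)%E.
  have cq : (0 <= (3 / 4 * (h * e) ^+ 2 * likelihood q x)%:E)%E.
    by rewrite EFinM mule_ge0.
  have cg : (0 <= ((h * e) ^+ 2 / 4 * likelihood g x)%:E)%E.
    by rewrite EFinM mule_ge0.
  rewrite ge0_integralZl// ge0_integralD//; last 4 first.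
  - by move=> y _; apply: adde_ge0; apply: mule_ge0 => //; exact: loss0.
  - by apply: emeasurable_funD; apply: measurable_funeM; exact: mloss.
  - by move=> y _; apply: mule_ge0.
  - by apply: measurable_funeM; exact: mcell.
  rewrite ge0_integralD//; last 4 first.
  - by move=> y _; apply: mule_ge0 => //; exact: loss0.
  - by apply: measurable_funeM; exact: mloss.
  - by move=> y _; apply: mule_ge0 => //; exact: loss0.
  - by apply: measurable_funeM; exact: mloss.
  rewrite !ge0_integralZl//; last 4 first.
  - exact: mloss.
  - by move=> y _; exact: loss0.
  - exact: mloss.
  - by move=> y _; exact: loss0.
  rewrite integral_bit_cell -!EFinM.
  rewrite [(_ * likelihood q x * _)%R]mulrAC [(_ * likelihood g x * _)%R]mulrAC.
  apply.
  - by move=> y _; apply: mule_ge0.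
  - by apply: measurable_funeM; exact: mcell.
  - by apply: emeasurable_funD; [apply: emeasurable_funD|]; apply: measurable_funeM;
      [exact: mloss|exact: mloss|exact: mcell].
  - by move=> y _; rewrite -!EFinM -!EFinD lee_fin bit_pair_pointwise.
have lp w0 x : (0 <= (likelihood (bit_density w0) x)%:E * bit_loss T w0 j x)%E.
  by rewrite mule_ge0 ?bit_loss_ge0// L0'//; exact: bit_density_ge0.
have mlp w0 : measurable_fun setT (fun x => (likelihood (bit_density w0) x)%:E *
    bit_loss T w0 j x)%E.
  apply: emeasurable_funM; first by apply: mL; exact: measurable_bit_density.
  exact: measurable_bit_loss.
have lq x : (0 <= (likelihood q x)%:E)%E by exact: L0'.
have lg x : (0 <= (likelihood g x)%:E)%E by apply: L0'; exact: bit_ratio_ge0.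
have cg : (0 <= ((h * e) ^+ 2 / 4 * (2 * v))%:E)%E by rewrite lee_fin mulr_ge0.
have cq : (0 <= (3 / 4 * (h * e) ^+ 2 * (2 * v))%:E)%E by rewrite lee_fin mulr_ge0.
(* Over the samples, the likelihood of [q] integrates to 1 and that of [g] to [(1 + e^2 / m)^n]. *)
have := ge0_integral_prod_tnth n mg bit_ratio_ge0 integral_bit_ratio.
have := ge0_integral_prod_tnth n mq q0 q1.
rewrite expr1n => intq intg.
rewrite -[leLHS]mule1 -intq -ge0_integralZl//; last exact: mL.
rewrite [X in (_ <= _ + X)%E]EFinM -intg -ge0_integralZl//; last exact: mL.
rewrite /bit_risk /sample_expectation -ge0_integralD// -ge0_integralD//; last first.
- by apply: measurable_funeM; exact: mL.
- by move=> x _; rewrite mule_ge0.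
- exact: emeasurable_funD.
- by move=> x _; rewrite adde_ge0.
apply: ge0_le_integral => //.
- by move=> x _; rewrite mule_ge0.
- by apply: measurable_funeM; exact: mL.
- apply: emeasurable_funD; first exact: emeasurable_funD.
  by apply: measurable_funeM; exact: mL.
Qed.

End pair.

(** * Averaging over the hypercube of bits *)

Section lower_bound.
Context (n : nat) (T : n.-tuple (Rd R d) -> Rd R d -> R).
Hypotheses (mT : is_estimator T) (ne : n%:R * (e ^+ 2 / m%:R) <= 2^-1).

Lemma bit_risk_flip_ge w j : (((h * e) ^+ 2 / 4 * (2 * v))%:E <=
  bit_risk T w j + bit_risk T (flip_bit j w) j)%E.
Proof.
(* The claim is symmetric in [w] and its flip, while the comparison of two densities takes the first
   with bit [j] off. *)
wlog wj : w / w j = false.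
  move=> H; have [wj|wj] := boolP (w j); last by apply: H; exact/negbTE.
  have wj' : flip_bit j w j = false by rewrite ffunE eqxx wj.
  have := H (flip_bit j w) wj'; rewrite flip_bitK => /le_trans; apply.
  by rewrite [leLHS]addeC lexx.
have := @bit_risk_pair_ge w (flip_bit j w) j wj _ _ n T mT.
rewrite ffunE eqxx wj => /(_ erefl).
have ww' i : i != j -> flip_bit j w i = w i by rewrite ffunE => /negbTE ->.
move=> /(_ ww').
set D := (h * e) ^+ 2; set E := _ ^+ n => key.
have D0 : 0 <= D * v by rewrite mulr_ge0 ?sqr_ge0// ltW.
have E2 : E <= 2 by apply: exp1D_le2 => //; rewrite divr_ge0 ?sqr_ge0.
rewrite -(leeD2rE _ _ (x := (D / 4 * (2 * v) * E)%:E))//.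
apply: le_trans key; rewrite -EFinD lee_fin.
exact: quarter_add_le.
Qed.

Lemma assouad_bound (S : \bar R) :
  (forall w, (risk T (bit_density w) <= S)%E) ->
  ((m%:R * ((h * e) ^+ 2 / 4 * (2 * v)) / 2)%:E <= S)%E.
Proof.
move=> riskS.
have rS w : (\sum_(j < m) bit_risk T w j <= S)%E.
  exact: le_trans (sum_bit_risk_le mT w) (riskS w).
have r0 w j : (0 <= bit_risk T w j)%E.
  apply: integral_ge0 => x _; rewrite mule_ge0 ?bit_loss_ge0// lee_fin prodr_ge0// => i _.
  exact: bit_density_ge0.
(* For finite [S] all the localized risks are finite, so the averaging can take place in [R]. *)
case: S {riskS} rS => [s| |] rS; [|exact: leey|]; last first.
  have := rS [ffun=> true]; rewrite leeNy_eq => /eqP H.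
  have : (0 <= \sum_(j < m) bit_risk T [ffun=> true] j)%E by apply: sume_ge0.
  by rewrite H.
have rfin w j : bit_risk T w j \is a fin_num.
  rewrite ge0_fin_numE//; apply: le_lt_trans (ltry s); apply: le_trans (rS w).
  by rewrite (bigD1 j)//= leeDl// sume_ge0.
rewrite lee_fin.
apply: (assouad_sum (r := fun w j => fine (bit_risk T w j))) => [w j|w].
  have := bit_risk_flip_ge w j.
  by rewrite -(fineK (rfin w j)) -(fineK (rfin (flip_bit j w) j)) -EFinD lee_fin.
rewrite -lee_fin -sumEFin; under eq_bigr do rewrite fineK//.
exact: rS.
Qed.

End lower_bound.

End assouad.

(** * Mixtures forming a hypercube *)

Section hypercube.
Context (R : realType) (d m : nat) (L : R).
Hypotheses (L0 : 0 < L) (m0 : (0 < m)%N).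
Variable B : 'I_m * bool -> set (Rd R d).
Hypotheses (mB : forall i, measurable (B i))
  (muB : forall i, leb R d (B i) = (L * m%:R)^-1%:E).
Hypothesis dB : forall i j y, B i y -> B j y -> i = j.

(* The weights of the bit functions in the mixtures are proportional to [e / m];
   their scaling makes these mixtures lie in the simplex for every [e <= 1],
   so that the same functions serve all sample sizes. *)
Definition hypercube_functions (i : 'I_m.+1) : Rd R d -> R :=
  if unlift ord0 i is Some j
  then step B (fun k => L * m%:R * bit_sign R k.2 * (k.1 == j)%:R)
  else step B (fun=> L).

Lemma hypercube_functions_L2 : in_L2 hypercube_functions.
Proof.
by move=> i; rewrite /hypercube_functions; case: unliftP => [j|] _;
  exact: step_Lfun2 mB muB dB _.
Qed.

Lemma bit_density_mixture (e : R) (w : {ffun 'I_m -> bool}) : 0 <= e <= 1 ->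
  exists2 lam, subsimplex R m.+1 lam &
    mixture hypercube_functions lam = bit_density L e B w.
Proof.
move=> /andP[e0 e1].
have mR : 0 < m%:R :> R by rewrite ltr0n.
(* With weight 1/2 on the constant height [L], the total weight is at most [1/2 + e/2 <= 1]. *)
pose mu : m.-tuple R := [tuple (w j)%:R * (e / (2 * m%:R)) | j < m].
have em0 : 0 <= e / (2 * m%:R) by rewrite divr_ge0// mulr_ge0.
exists [tuple of 2^-1 :: mu].
  split=> [i|].
    have [j ->|->] := unliftP ord0 i; last by rewrite tnth0.
    by rewrite tnthS tnth_mktuple mulr_ge0.
  rewrite big_ord_recl tnth0.
  under eq_bigr do rewrite tnthS tnth_mktuple.
  apply: (@le_trans _ _ (2^-1 + \sum_(j < m) e / (2 * m%:R))).
    by rewrite lerD2l; apply: ler_sum => j _; rewrite ler_piMl//; case: (w j).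
  rewrite sumr_const card_ord -[X in _ + X]mulr_natl.
  rewrite (_ : m%:R * _ = e / 2); last by field; rewrite gt_eqF.
  lra.
apply/funext => y; rewrite /mixture big_ord_recl tnth0 /hypercube_functions unlift_none.
under eq_bigr => j _ do rewrite liftK tnthS tnth_mktuple.
apply: (step_cases dB (P := fun f => 2^-1 * f (fun=> L) +
  \sum_(j < m) (w j)%:R * (e / (2 * m%:R)) *
    f (fun k => L * m%:R * bit_sign R k.2 * (k.1 == j)%:R) =
  f (bit_coef L e w))).
  move=> k; rewrite (bigD1 k.1)//= eqxx big1 ?addr0.
    by rewrite /bit_coef mulr1; set b := (w k.1)%:R; field; rewrite gt_eqF.
  by move=> j /negbTE; rewrite eq_sym => ->; rewrite !mulr0.
by rewrite mulr0 add0r big1// => j _; rewrite mulr0.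
Qed.

Lemma hypercube_max_excess_risk_ge (n : nat) (K : R)
    (T : n.-tuple (Rd R d) -> Rd R d -> R) :
  (0 < n)%N -> 1 <= K -> m%:R <= K * n%:R -> is_estimator T ->
  ((L * m%:R / (64 * K * n%:R))%:E <= max_excess_risk (bounded_densities R d L)
     (subsimplex R m.+1) hypercube_functions T)%E.
Proof.
move=> n0 K1 mKn mT.
have mR : 0 < m%:R :> R by rewrite ltr0n.
have nR : 0 < n%:R :> R by rewrite ltr0n.
have K0 : 0 < K by apply: lt_le_trans K1.
(* The value of [e^2]: [m <= K n] gives [e <= 1/2], and [K >= 1] gives
   [n e^2 / m = 1 / (4 K) <= 1/2]. *)
pose z := m%:R / (4 * K * n%:R).
have z0 : 0 <= z by rewrite divr_ge0// !mulr_ge0// ltW.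
pose e := Num.sqrt z.
have e0 : 0 <= e by exact: sqrtr_ge0.
have e2 : e ^+ 2 = z by rewrite sqr_sqrtr.
have z4 : z <= 2^-1 ^+ 2.
  rewrite ler_pdivrMr ?mulr_gt0//.
  by rewrite (_ : 2^-1 ^+ 2 * _ = K * n%:R)//; field.
have e1 : e <= 2^-1.
  by rewrite -(ler_pXn2r (n := 2)) ?nnegrE// e2.
have ne : n%:R * (e ^+ 2 / m%:R) <= 2^-1.
  rewrite e2 (_ : _ * _ = (4 * K)^-1); last by rewrite /z; field; rewrite !gt_eqF.
  by rewrite lef_pV2 ?posrE ?mulr_gt0//; lra.
have riskS w : (risk T (bit_density L e B w) <= max_excess_risk
    (bounded_densities R d L) (subsimplex R m.+1) hypercube_functions T)%E.
  have e01 : 0 <= e <= 1 by rewrite e0/=; lra.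
  have [lam slam mixE] := bit_density_mixture w e01.
  set p := bit_density L e B w in mixE *.
  have oracle_le0 : (oracle_risk (subsimplex R m.+1) hypercube_functions p <= 0)%E.
    apply: ereal_inf_lbound; exists lam => //.
    rewrite mixE sqr_L2norm; under eq_integral do rewrite /= subrr expr0n.
    by rewrite integral0.
  apply: (@le_trans _ _
      (risk T p - oracle_risk (subsimplex R m.+1) hypercube_functions p)%E).
    by rewrite leeDl// oppe_ge0.
  apply: ereal_sup_ubound; exists p => //.
  exact: bit_density_bounded.
apply: le_trans (assouad_bound L0 m0 e0 e1 mB muB dB mT ne riskS).
(* Assouad's bound [m (h e)^2 v / 4] is exactly [L m / (64 K n)] for [h = L / 2] and
   [v = 1 / (L m)]. *)
rewrite lee_fin le_eqVlt; apply/orP; left; apply/eqP.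
rewrite [(_ * e) ^+ 2]exprMn e2 /z.
by field; rewrite !gt_eqF.
Qed.

End hypercube.

(** * Constants of the rate and assembly of the two bounds *)

Theorem corollary3p2 (R : realType) (d : nat) (L c0 : R) (hd : (1 <= d)%N)
    (hL : 0 < L) (hc0 : 0 < c0) :
  let adm M n := [/\ (2 <= M)%N, (1 <= n)%N & M%:R <= c0 * n%:R] in
  let psi n M := L * M%:R / n%:R in
  optimal_aggregation_rate adm (subsimplex R) (bounded_densities R d L) psi /\
  rate_optimal_aggregate adm (subsimplex R) (bounded_densities R d L) psi
    (convex_aggregate R d).
Proof.
move=> adm psi.
have lower : aggregation_lower_bound adm (subsimplex R) (bounded_densities R d L) psi.
  have K0 : 0 < 1 + c0 by rewrite addr_gt0.
  (* This is [64 K] with [K = 1 + c0], doubled because [M <= 2 (M - 1)]. *)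
  exists (128 * (1 + c0))^-1; first by rewrite invr_gt0 mulr_gt0.
  (* The sizes 0 and 1 are not admissible, so zero functions do. For [M = m.+2] one function is the
     constant height and [m.+1] carry the bits. *)
  case=> [|[|m]].
  - exists (fun _ => cst 0) => [|n []//].
    by case.
  - exists (fun _ => cst 0) => [j|n []//].
    apply: measurable_sqr_Lfun2 => //.
    by under eq_integral do rewrite expr0n; rewrite integral0 ltry.
  have v0 : 0 < (L * m.+1%:R)^-1 by rewrite invr_gt0 mulr_gt0.
  have [B [mB muB dB]] := exists_disjoint_cells ('I_m.+1 * bool)%type hd v0.
  exists (hypercube_functions L B).
    exact: hypercube_functions_L2 mB muB dB.
  move=> n [_ n0 Mn] T mT.
  have nR : 0 < n%:R :> R by rewrite ltr0n.
  have mM : (m.+2%:R : R) = m.+1%:R + 1 by rewrite -natr1.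
  have m1 : 1 <= m.+1%:R :> R by rewrite ler1n.
  have := @hypercube_max_excess_risk_ge R d m.+1 L hL isT B mB muB dB n (1 + c0) T n0.
  move=> /(_ _ _ mT); set S := max_excess_risk _ _ _ _ => H.
  apply: le_trans (H _ _); last 2 first.
  - by rewrite lerDl ltW.
  - by rewrite mulrDl mul1r; lra.
  rewrite lee_fin /psi mM.
  rewrite (_ : L * m.+1%:R / _ = (128 * (1 + c0))^-1 * (L * (2 * m.+1%:R) / n%:R)).
    rewrite ler_wpM2l ?invr_ge0 ?mulr_ge0 ?(ltW K0)//.
    by rewrite ler_wpM2r ?invr_ge0// ler_wpM2l ?(ltW hL)//; lra.
  by field; rewrite !gt_eqF.
have upper : forall (M : nat) (ps : 'I_M -> Rd R d -> R), in_L2 ps ->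
    forall n, adm M n -> forall T, convex_aggregate R d M ps n T ->
      (max_excess_risk (bounded_densities R d L) (subsimplex R M) ps T <=
       (1 * psi n M)%:E)%E.
  move=> M ps psL2 n [_ n0 _] T aggT.
  by rewrite mul1r; exact: max_excess_risk_convex_aggregate_le.
split; split => //.
- by move=> M n [M2 n0 _]; rewrite /psi divr_gt0 ?mulr_gt0 ?ltr0n// (leq_trans _ M2).
- exists 1 => M ps psL2.
  pose T n := sval (cid (exists_convex_aggregate n psL2)).
  have TP n : convex_aggregate R d M ps n (T n) :=
    svalP (cid (exists_convex_aggregate n psL2)).
  by exists T => n admMn; split; [case: (TP n)|exact: upper].
- exists 1 => M ps psL2 n admMn; split; [exact: exists_convex_aggregate| |].
    by move=> T [].
  exact: upper.
Qed.
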